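(* Let $(V,\omega,\mu)$ be an infinite weighted graph satisfying Assumption (A$'$) (see context), with pseudo metric $d$, point $x_0\in V$ and constants $R_0>1$, $\alpha\in[0,1]$ as in Assumption (A$'$). Let $v:V\times[0,\infty)\to\mathbb{R}$ be a positive function, $\sigma>1$, $\delta>0$. Let $u:V\times[0,\infty)\to\mathbb{R}$ be a very weak solution (no sign assumption) of $$u_{tt}-\Delta u\ge v|u|^\sigma\ \text{ in }V\times(0,\infty),\qquad u=u_0\ \text{ in }V\times\{0\},\qquad u_t=u_1\ \text{ in }V\times\{0\}.$$ Suppose that $$\sum_{x\in V}u_1(x)\mu(x)\ge 0,$$ that $u_0,u_1\in X_\delta$ and $u\in L^1_{loc}([0,\infty),X_\delta)$. Moreover, suppose that there is a constant $C>0$ such that for every $R\ge R_0$ $$\int_{R^{\frac{1+\alpha}{2}}}^{2R^{\frac{1+\alpha}{2}}}\sum_{x\in B_R(x_0)}v^{-\frac{1}{\sigma-1}}(x,t)\,e^{-\delta\frac{d(x,x_0)}{R}}\mu(x)\,dt\le C R^{\frac{(\alpha+1)\sigma}{\sigma-1}}$$ and $$\int_{0}^{2R^{\frac{1+\alpha}{2}}}\sum_{x\in V\setminus B_R(x_0)}v^{-\frac{1}{\sigma-1}}(x,t)\,e^{-\delta\frac{d(x,x_0)}{R}}\mu(x)\,dt\le C R^{\frac{(\alpha+1)\sigma}{\sigma-1}}.$$ Then $u\equiv 0$.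
   Context: Weighted graph: a triple $(V,\omega,\mu)$ where $V$ is a countable set, $\mu:V\to(0,\infty)$, and $\omega:V\times V\to[0,\infty)$ satisfies $\omega_{xy}=\omega_{yx}$, $\omega_{xx}=0$ and $\sum_{y\in V}\omega_{xy}<\infty$ for all $x,y\in V$. Write $x\sim y$ if $\omega_{xy}>0$. The graph is locally finite if each $x$ has finitely many $y\sim x$; connected if any two distinct vertices are joined by a finite path $x_0\sim x_1\sim\dots\sim x_n$; undirected if edges have no orientation (automatic from symmetry of $\omega$). Laplacian: $\Delta f(x)=\frac{1}{\mu(x)}\sum_{y\sim x}\omega_{xy}\,(f(y)-f(x))$ for $f:V\to\mathbb{R}$; for functions on $V\times[0,\infty)$ it acts in the variable $x$. A pseudo metric on $V$ is a symmetric map $d:V\times V\to[0,\infty)$ with $d(x,x)=0$ satisfying the triangle inequality (possibly $d(x,y)=0$ for $x\ne y$). Its jump size is $j:=\sup\{d(x,y):x,y\in V,\ \omega_{xy}>0\}$. Balls: $B_r(x)=\{y\in V:d(x,y)<r\}$. Assumption (A$'$): (i) $(V,\omega,\mu)$ is connected, locally finite, undirected; (ii) there is $C>0$ such that $\sum_{y\sim x}\omega_{xy}\le C\mu(x)$ for every $x\in V$; (iii) there is a pseudo metric $d$ on $V$ whose jump size $j$ is finite; (iv) for this $d$, $B_r(x)$ is a finite set for all $x\in V$, $r>0$; (v$'$) for some $x_0\in V$, $R_0>1$, $\alpha\in[0,1]$, $C>0$, $|\Delta d(x,x_0)|\le \frac{C}{d^\alpha(x,x_0)}$ for every $x\in V\setminus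 B_{R_0}(x_0)$ (Laplacian taken in $x$). Weighted space: $X_\delta=\{f:V\to\mathbb{R}: \|f\|_{X_\delta}:=\sum_{x\in V}|f(x)|e^{-\delta d(x,x_0)}\mu(x)<\infty\}$; $u\in L^1_{loc}([0,\infty),X_\delta)$ means $\int_0^T\|u(\cdot,t)\|_{X_\delta}\,dt<\infty$ for every $T>0$. Very weak solution: $u:V\times[0,\infty)\to\mathbb{R}$ with $u(x,\cdot)\in L^1_{loc}([0,\infty))\cap L^\sigma_{loc}([0,\infty),v(x,t)dt)$ for every $x\in V$, such that $$\int_0^\infty\sum_{x\in V}u\,\varphi_{tt}\,\mu(x)\,dt-\int_0^\infty\sum_{x\in V}\Delta u\,\varphi\,\mu(x)\,dt+\sum_{x\in V}u_0(x)\varphi_t(x,0)\mu(x)-\sum_{x\in V}u_1(x)\varphi(x,0)\mu(x)\ge\int_0^\infty\sum_{x\in V}v|u|^\sigma\varphi\,\mu(x)\,dt$$ for every $\varphi:V\times[0,\infty)\to\mathbb{R}$ with $\varphi\ge0$, $\operatorname{supp}\varphi\subset A\times[0,T]$ for some $T>0$ and some finite $A\subset V$, and $\varphi(x,\cdot)\in C^2([0,\infty))$ for every $x\in V$. Here $u_0,u_1:V\to\mathbb{R}$. Conventions: $v(x,\cdot)$ is Lebesgue measurable for each $x$; functions $u(x,\cdot)$ are identified when equal almost everywhere, so $u\equiv0$ means $u(x,t)=0$ for every $x\in V$ and a.e. $t\ge0$. The sum $\sum_{x\in V}u_1(x)\mu(x)$ is understood as a well-defined unordered sum in $[-\infty,+\infty]$,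 i.e. at least one of $\sum_{x\in V}u_1^+(x)\mu(x)$, $\sum_{x\in V}u_1^-(x)\mu(x)$ is finite, where $a^+=\max\{a,0\}$, $a^-=\max\{-a,0\}$. *)

(* Defs.v *)
From HB Require Import structures.
From mathcomp Require Import all_boot all_order all_algebra.
From mathcomp Require Import all_classical all_reals all_analysis.

Set Implicit Arguments.
Unset Strict Implicit.
Unset Printing Implicit Defensive.

Import Order.TTheory GRing.Theory Num.Theory.
Import numFieldNormedType.Exports.

Local Open Scope classical_set_scope.
Local Open Scope ring_scope.

(* The real line with its Lebesgue (not merely Borel) measurable sets: the
   domain of [completed_lebesgue_measure]. *)
Notation lebesgueType R :=
  (caratheodory_type ((@wlength R idfun)^*)%mu) (only parsing).
Notation leb := completed_lebesgue_measure.

Section graph.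
Context {R : realType} {V : countType}.
Implicit Types (omega d : V -> V -> R) (mu f : V -> R) (x y : V) (r : R).

Record weighted_graph omega mu : Prop := WeightedGraph {
  vertex_weight_gt0 : forall x, 0 < mu x ;
  edge_weight_ge0 : forall x y, 0 <= omega x y ;
  edge_weight_sym : forall x y, omega x y = omega y x ;
  edge_weight_diag : forall x, omega x x = 0 ;
  edge_weight_summable : forall x,
    ((\esum_(y in [set: V]) (omega x y)%:E) < +oo)%E }.

Definition adj omega : rel V := fun x y => 0 < omega x y.

Definition neighbors omega x : set V := [set y | adj omega x y].

Definition locally_finite_graph omega : Prop :=
  forall x, finite_set (neighbors omega x).

Definition connected_graph omega : Prop :=
  forall x y, x != y -> exists2 p : seq V, path (adj omega) x p & last x p = y.

(* The sum has finite support as soon as the graph is locally finite, which is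
   the only case in which this definition is used. *)
Definition laplacian omega mu f x : R :=
  (mu x)^-1 * \sum_(y \in neighbors omega x) (omega x y * (f y - f x)).

Record pseudo_metric d : Prop := PseudoMetric {
  pseudo_metric_ge0 : forall x y, 0 <= d x y ;
  pseudo_metric_sym : forall x y, d x y = d y x ;
  pseudo_metric_xx : forall x, d x x = 0 ;
  pseudo_metric_triangle : forall x y z, d x z <= d x y + d y z }.

Definition jump_size omega d : \bar R :=
  ereal_sup [set (d xy.1 xy.2)%:E | xy in [set xy | 0 < omega xy.1 xy.2]].

Definition dball d x r : set V := [set y | d x y < r].

Record assumptionA' omega mu d x0 (R0 alpha : R) : Prop := AssumptionA' {
  A'_connected : connected_graph omega ;
  A'_locally_finite : locally_finite_graph omega ;
  A'_degree : exists2 C : R, 0 < C &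
    forall x, ((\esum_(y in neighbors omega x) (omega x y)%:E)
               <= (C * mu x)%:E)%E ;
  A'_pseudo_metric : pseudo_metric d ;
  A'_jump_size : (jump_size omega d < +oo)%E ;
  A'_finite_balls : forall x r, 0 < r -> finite_set (dball d x r) ;
  A'_R0 : 1 < R0 ;
  A'_alpha : 0 <= alpha <= 1 ;
  A'_laplacian_distance : exists2 C : R, 0 < C &
    forall x, ~ dball d x0 R0 x ->
      `|laplacian omega mu (fun y => d y x0) x| <= C / (d x x0 `^ alpha) }.

Definition Xnorm mu d x0 (delta : R) f : \bar R :=
  \esum_(x in [set: V]) (`|f x| * expR (- (delta * d x x0)) * mu x)%:E.

Definition in_X mu d x0 (delta : R) f : Prop :=
  (Xnorm mu d x0 delta f < +oo)%E.

Definition L1loc_X mu d x0 (delta : R) (u : V -> R -> R) : Prop :=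
  forall T : R, 0 < T ->
    ((\int[leb]_(t in `[0%R, T]) Xnorm mu d x0 delta (u^~ t)) < +oo)%E.

Definition sum_pos mu f : \bar R :=
  \esum_(x in [set: V]) (Num.max (f x) 0 * mu x)%:E.
Definition sum_neg mu f : \bar R :=
  \esum_(x in [set: V]) (Num.max (- f x) 0 * mu x)%:E.

Definition sum_well_defined mu f : Prop :=
  (sum_pos mu f < +oo)%E \/ (sum_neg mu f < +oo)%E.

Definition signed_sum mu f : \bar R := (sum_pos mu f - sum_neg mu f)%E.

End graph.

Section weak_solution.
Context {R : realType} {V : countType}.
Implicit Types (omega : V -> V -> R) (u v : V -> R -> R).

(* Functions on [0, +oo[ are represented by functions on R whose values on the
   negative half-line are never used; in particular the derivative at 0 is the
   right derivative. *)
Definition halfline_derivative (f f' : R -> R) : Prop :=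
  forall t : R, 0 <= t ->
    (f s - f t) / (s - t) @[s --> within `[0, +oo[ t^'] --> f' t.

(* [f1] and [f2] are determined by [f] on [0, +oo[. *)
Definition halfline_C2 (f f1 f2 : R -> R) : Prop :=
  [/\ halfline_derivative f f1, halfline_derivative f1 f2 &
      {within `[0, +oo[, continuous f2}].

(* Since A `*` [0, T] is closed, the support of [phi] is contained in it as soon
   as [phi] vanishes outside of it. *)
Definition test_function (phi phi_t phi_tt : V -> R -> R) : Prop :=
  [/\ forall x (t : R), 0 <= t -> 0 <= phi x t,
      exists A : set V, exists T : R, [/\ finite_set A, 0 < T &
        forall x (t : R), 0 <= t -> phi x t != 0 -> A x /\ t <= T] &
      forall x, halfline_C2 (phi x) (phi_t x) (phi_tt x)].

(* In the last field all the sums over V are finite sums and all the integrals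
   are finite, by [vws_L1loc], [vws_Lsigmaloc], the compact support of [phi] and
   the local finiteness of the graph. *)
Record very_weak_solution omega (mu : V -> R) v (sigma : R)
    (u0 u1 : V -> R) u : Prop :=
  VeryWeakSolution {
  vws_L1loc : forall x (T : R), 0 < T ->
    leb.-integrable `[0, T] (fun t => (u x t)%:E) ;
  vws_Lsigmaloc : forall x (T : R), 0 < T ->
    leb.-integrable `[0, T] (fun t => (`|u x t| `^ sigma * v x t)%:E) ;
  vws_ineq : forall phi phi_t phi_tt, test_function phi phi_t phi_tt ->
    (\int[leb]_(t in `[0, +oo[)
        (\sum_(x \in [set: V]) (u x t * phi_tt x t * mu x)))
    - (\int[leb]_(t in `[0, +oo[)
        (\sum_(x \in [set: V]) (laplacian omega mu (u^~ t) x * phi x t * mu x)))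
    + (\sum_(x \in [set: V]) (u0 x * phi_t x 0 * mu x))
    - (\sum_(x \in [set: V]) (u1 x * phi x 0 * mu x))
    >= \int[leb]_(t in `[0, +oo[)
        (\sum_(x \in [set: V]) (v x t * `|u x t| `^ sigma * phi x t * mu x)) }.

End weak_solution.

(* Main.v *)
Require Import Defs.
From HB Require Import structures.
From mathcomp Require Import all_boot all_order all_algebra.
From mathcomp Require Import all_classical all_reals all_analysis.
From mathcomp Require Import measurable_realfun finmap ring lra.

Set Implicit Arguments.
Unset Strict Implicit.
Unset Printing Implicit Defensive.

Import Order.TTheory GRing.Theory Num.Theory.
Import numFieldNormedType.Exports.

Local Open Scope classical_set_scope.
Local Open Scope ring_scope.

(** The inequality is tested with products of a cutoff [th] in time, equal to 1 up to
    [T = s ^ ((1 + alpha) / 2)] and to 0 after [2 T], and a weight [psi] in space, equal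
    to 1 on the ball of radius [s] and decaying like [exp (- delta * d / s)] at
    infinity. The second derivative of [th] and the Laplacian of [psi] are both of
    order [s ^ (- (1 + alpha))] relative to the test function: the first since
    [T ^ 2 = s ^ (1 + alpha)], the second since [psi] is a function of the distance,
    whose Laplacian is [O(d ^ (- alpha))], with second order terms of order
    [s ^- 2]. Moreover the former is supported in [T, 2 T] and the latter outside of
    the ball of radius [s]. Young's inequality with a parameter [lam] bounds the
    reaction, that is the sum of [v |u| ^ sigma] against the test function, by
    [lam] times the reaction in that region, plus [lam ^ (- 1 / (sigma - 1))] times
    [s ^ (- (1 + alpha) sigma / (sigma - 1))] times the volume integrals of the
    hypotheses. The growth allowed for these integrals is exactly the one that keeps
    the last term bounded in [s] ([scale_estimate]). The initial velocity enters
    with the right sign, up to an arbitrarily small error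
    ([initial_velocity_bound]).

    For [lam = 1 / 4] the reaction on the right is absorbed, so the total reaction
    is finite. Its part after time [T] or outside of the ball of radius [s] therefore
    tends to 0 as [s] grows, and the same estimate gives that the total reaction is
    at most a constant times [lam ^ (- 1 / (sigma - 1))]. Letting [lam] grow, it
    vanishes, and so does [u] because [v] is positive.

    One point needs care: test functions have finite support, and truncating [psi]
    creates an error that involves [u] without any power of [v]. It is controlled
    by the summability of [u] against [exp (- delta * d)], a weight that decays faster
    than [psi]. Hence [psi] is first given the additional rate of decay [delta] beyond
    a distance [n] ([weight]). For fixed [n] the truncation error then tends to 0 as
    the truncation radius grows; the Laplacian created by the additional decay is
    merely of the order of the weight, but it lives near and beyond distance [n],
    and Young's inequality turns it into a tail of a convergent volume sum, small for
    large [n] ([weighted_absorption]). *)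

(** * The cutoff in time *)

Section cutoff_in_time.
Context {R : realType}.
Implicit Types (f : R -> R) (s t T : R) (k m : nat).

Lemma is_derive_halfline f (f' : R -> R) :
  (forall t, is_derive t 1 f (f' t)) -> halfline_derivative f f'.
Proof.
move=> df t _; have /is_derive1_caratheodory [g [gE gc <-]] := df t.
apply: cvg_within_filter.
have /cvg_within_filter gt : g s @[s --> t] --> g t by exact: gc.
apply: cvg_trans (gt (fun x => x != t)).
apply: near_eq_cvg; near=> s.
have st : s != t by near: s; exact: nbhs_dnbhs_neq.
by rewrite gE mulfK// subr_eq0.
Unshelve. all: by end_near. Qed.

Definition ppow k s : R := Num.max 0 s ^+ k.

Lemma ppow_ge0 k s : 0 <= ppow k s.
Proof. by rewrite exprn_ge0// le_max lexx. Qed.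

Lemma ppow_eq0 k s : s <= 0 -> ppow k.+1 s = 0.
Proof. by move=> s0; rewrite /ppow max_l// expr0n. Qed.

Lemma ppowE k s : 0 <= s -> ppow k s = s ^+ k.
Proof. by move=> s0; rewrite /ppow max_r. Qed.

Lemma ppow_le1 k s : s <= 1 -> ppow k s <= 1.
Proof. by move=> s1; rewrite exprn_ile1// ?le_max ?lexx// ge_max ler01. Qed.

Lemma ppowS k s : ppow k.+2 s = ppow k.+1 s * s.
Proof.
have [s0|/ltW s0] := leP s 0; first by rewrite !ppow_eq0// mul0r.
by rewrite !ppowE// -exprSr.
Qed.

Lemma ppow_continuous k : continuous (ppow k).
Proof.
move=> s; apply: (@continuous_comp _ _ _ (fun s => Num.max 0 s) (fun s => s ^+ k)).
  apply: (@continuous_max _ _ (cst 0) id); [exact: cst_continuous|exact: cvg_id].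
exact: exprn_continuous.
Qed.

Lemma is_derive_ppow k s : is_derive s 1 (ppow k.+2) (k.+2%:R * ppow k.+1 s).
Proof.
have [s0|s0|->] := ltgtP s 0.
- rewrite ppow_eq0 ?ltW// mulr0.
  apply: (@near_eq_is_derive _ _ _ (cst 0)).
  near=> z; rewrite ppow_eq0//= ltW//; near: z; exact: lt_nbhsl.
- rewrite ppowE ?ltW//.
  have dX : is_derive s 1 (fun z : R => z ^+ k.+2) (k.+2%:R * s ^+ k.+1).
    have := @is_deriveX _ _ id k.+2 s 1 1 (is_derive_id s 1).
    by rewrite exprfctE scaler1.
  apply: near_eq_is_derive dX.
  near=> z; rewrite ppowE//= ltW//; near: z; exact: lt_nbhsr.
- apply/is_derive1_caratheodory; exists (ppow k.+1); split.
  + by move=> z; rewrite (ppow_eq0 _ (lexx 0)) !subr0 ppowS.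
  + exact: ppow_continuous.
  + by rewrite ppow_eq0// mulr0.
Unshelve. all: by end_near. Qed.

Variable M : nat.

(** Young's inequality needs a second derivative bounded by the power
    [sigma^-1] of the function. Differentiating the power [M + 3] of a profile
    twice leaves its power [M + 1], and this is at most the power
    [(M + 3) / sigma] once [M] is large; the inner cube makes the junction at
    [1] twice continuously differentiable. *)
Definition bump s : R := ppow M.+3 (1 - ppow 3 (s - 1)).
Definition bump1 s : R :=
  - ((3 * M.+3)%:R * (ppow M.+2 (1 - ppow 3 (s - 1)) * ppow 2 (s - 1))).
Definition bump2 s : R :=
  M.+3%:R * (9 * M.+2%:R * (ppow M.+1 (1 - ppow 3 (s - 1)) * ppow 2 (s - 1) ^+ 2)
             - 6 * (ppow M.+2 (1 - ppow 3 (s - 1)) * ppow 1 (s - 1))).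

Lemma is_derive_inner k s :
  is_derive s 1 (fun s => ppow k.+2 (s - 1)) (k.+2%:R * ppow k.+1 (s - 1)).
Proof.
have ds : is_derive s 1 (fun s : R => s - 1) 1.
  by have := is_deriveB (is_derive_id s 1) (is_derive_cst (1 : R) s 1); rewrite subr0.
have := @is_derive1_comp _ (ppow k.+2) (fun s => s - 1) _ _ _ (is_derive_ppow k _) ds.
by rewrite mulr1.
Qed.

Lemma is_derive_outer k s :
  is_derive s 1 (fun s => ppow k.+2 (1 - ppow 3 (s - 1)))
    (- (3 * k.+2%:R * (ppow k.+1 (1 - ppow 3 (s - 1)) * ppow 2 (s - 1)))).
Proof.
have ds : is_derive s 1 (fun s : R => 1 - ppow 3 (s - 1)) (- (3 * ppow 2 (s - 1))).
  have := is_deriveB (is_derive_cst (1 : R) s 1) (is_derive_inner 1 s).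
  by rewrite sub0r.
have := @is_derive1_comp _ (ppow k.+2) (fun s => 1 - ppow 3 (s - 1)) _ _ _
  (is_derive_ppow k _) ds.
by rewrite mulrN; congr (is_derive _ _ _ (- _)); ring.
Qed.

Lemma is_derive_bump s : is_derive s 1 bump (bump1 s).
Proof. by rewrite /bump1 natrM; exact: is_derive_outer. Qed.

Lemma is_derive_bump1 s : is_derive s 1 bump1 (bump2 s).
Proof.
have H := is_deriveN (is_deriveZ (3 * M.+3)%:R
  (is_deriveM (is_derive_outer M s) (is_derive_inner 0 s))).
refine (is_derive_eq (f := bump1) H _).
rewrite /bump2 -![_ *: _]/(_ * _) !natrM; ring.
Qed.

Lemma outer_continuous k l : continuous (fun s => ppow k (1 - ppow l (s - 1))).
Proof.
move=> s; apply: (@continuous_comp _ _ _ (fun s => 1 - ppow l (s - 1)) (ppow k)); last first.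
  exact: ppow_continuous.
apply: cvgB; first exact: cvg_cst.
apply: (@continuous_comp _ _ _ (fun s : R => s - 1) (ppow l)); last first.
  exact: ppow_continuous.
by apply: cvgB; [exact: cvg_id|exact: cvg_cst].
Qed.

Lemma inner_continuous k : continuous (fun s => ppow k (s - 1)).
Proof.
move=> s; apply: (@continuous_comp _ _ _ (fun s : R => s - 1) (ppow k)); last first.
  exact: ppow_continuous.
by apply: cvgB; [exact: cvg_id|exact: cvg_cst].
Qed.

Lemma bump2_continuous : continuous bump2.
Proof.
move=> s; apply: cvgM; first exact: cvg_cst.
apply: cvgB; (apply: cvgM; first exact: cvg_cst).
  apply: cvgM; first exact: outer_continuous.
  by apply: (@continuous_comp _ _ _ (fun s => ppow 2 (s - 1)) (fun x => x ^+ 2));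
    [exact: inner_continuous|exact: exprn_continuous].
by apply: cvgM; [exact: outer_continuous|exact: inner_continuous].
Qed.

Lemma bump_ge0 s : 0 <= bump s. Proof. exact: ppow_ge0. Qed.

Lemma inner_le1 s : 1 - ppow 3 (s - 1) <= 1.
Proof. by rewrite gerBl ppow_ge0. Qed.

Lemma bump_le1 s : bump s <= 1.
Proof. by rewrite ppow_le1 ?inner_le1. Qed.

Lemma bump_eq1 s : s <= 1 -> bump s = 1.
Proof.
by move=> s1; rewrite /bump (ppow_eq0 2) ?subr_le0// subr0 ppowE// expr1n.
Qed.

Lemma bump2_eq0 s : s <= 1 -> bump2 s = 0.
Proof.
by move=> s1; rewrite /bump2 (ppow_eq0 1) ?(ppow_eq0 0) ?subr_le0// expr0n/= !mulr0 subr0 mulr0.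
Qed.

Lemma bump1_eq0 s : s <= 1 -> bump1 s = 0.
Proof. by move=> s1; rewrite /bump1 (ppow_eq0 1) ?subr_le0// !mulr0 oppr0. Qed.

Lemma outer_eq0 k s : 2 <= s -> ppow k.+1 (1 - ppow 3 (s - 1)) = 0.
Proof.
move=> s2; rewrite ppow_eq0// subr_le0 ppowE; last by lra.
by rewrite exprn_ege1//; lra.
Qed.

Lemma bump_eq0 s : 2 <= s -> bump s = 0. Proof. exact: outer_eq0. Qed.

Lemma bump2_eq0r s : 2 <= s -> bump2 s = 0.
Proof. by move=> s2; rewrite /bump2 !outer_eq0// !mul0r !mulr0 subr0 mulr0. Qed.

(** The profile takes its values in [0, 1], so comparing powers of it reduces
    to comparing the exponents [M + 1] and [(M + 3) / sigma]. *)
Lemma bump2_bound (sigma : R) s : 0 < sigma ->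
  M.+3%:R <= M.+1%:R * sigma ->
  `|bump2 s| <= M.+3%:R * (9 * M.+2%:R + 6) * bump s `^ sigma^-1.
Proof.
move=> sigma0 Msigma.
have [s2|s2] := leP 2 s.
  by rewrite bump2_eq0r// normr0 mulr_ge0// ?powR_ge0// mulr_ge0// addr_ge0// mulr_ge0.
set q := Num.max 0 (1 - ppow 3 (s - 1)).
have q01 : 0 <= q <= 1 by rewrite le_max lexx ge_max ler01 inner_le1.
have r01 k : 0 <= ppow k (s - 1) <= 1 by rewrite ppow_ge0 ppow_le1//; lra.
have key : q ^+ M.+1 <= bump s `^ sigma^-1.
  rewrite /bump /ppow -/q -powR_mulrn; last by case/andP: q01.
  rewrite -powR_mulrn; last by case/andP: q01.
  rewrite -powRrM.
  have [->|q0] := eqVneq q 0.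
    by rewrite !powR0 ?lexx// ?mulf_neq0// ?invr_neq0// ?gt_eqF// pnatr_eq0.
  have q0' : 0 < q <= 1 by case/andP: q01 => q0' ->; rewrite lt_neqAle eq_sym q0 q0'.
  apply: ger_powR => //.
  by rewrite ler_pdivrMr.
have p0 k x : 0 <= ppow k x := ppow_ge0 k x.
rewrite /bump2 -/q normrM ger0_norm// -[leRHS]mulrA ler_pM2l ?ltr0n// [leRHS]mulrDl.
apply: (le_trans (ler_normB _ _)); apply: lerD.
- rewrite ger0_norm; last first.
    by apply: mulr_ge0; [exact: mulr_ge0|apply: mulr_ge0 => //; exact: exprn_ge0].
  rewrite ler_wpM2l ?mulr_ge0//; apply: le_trans key.
  rewrite -[leRHS]mulr1 ler_wpM2l ?exprn_ge0//; first by case/andP: q01.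
  by case/andP: (r01 2%N) => ? ?; rewrite exprn_ile1.
- rewrite ger0_norm; last by apply: mulr_ge0 => //; exact: mulr_ge0.
  rewrite ler_wpM2l//; apply: le_trans key.
  rewrite -[leRHS]mulr1 ler_pM ?ppow_ge0//; last by case/andP: (r01 1%N).
  by apply: ler_wiXn2l => //; case/andP: q01.
Qed.

End cutoff_in_time.

(** What the argument uses of the rescaled bump at time scale [T]. *)
Record time_cutoff {R : realType} (sigma K T : R) (th th1 th2 : R -> R) : Prop :=
  TimeCutoff {
  tc_derive : halfline_derivative th th1 ;
  tc_derive1 : halfline_derivative th1 th2 ;
  tc_continuous : continuous th ;
  tc_continuous2 : continuous th2 ;
  tc_ge0 : forall t, 0 <= th t ;
  tc_le1 : forall t, th t <= 1 ;
  tc_eq1 : forall t, t <= T -> th t = 1 ;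
  tc_eq0 : forall t, 2 * T <= t -> th t = 0 ;
  tc_init : th1 0 = 0 ;
  tc_eq02 : forall t, t <= T -> th2 t = 0 ;
  tc_eq02r : forall t, 2 * T <= t -> th2 t = 0 ;
  tc_bound : forall t, `|th2 t| <= K * T ^- 2 * th t `^ sigma^-1 }.

Lemma exists_time_cutoff {R : realType} (sigma : R) : 1 < sigma ->
  exists2 K : R, 0 < K &
    forall T : R, 0 < T -> exists th th1 th2, time_cutoff sigma K T th th1 th2.
Proof.
move=> sigma1; have sigma0 : 0 < sigma := lt_trans ltr01 sigma1.
(* makes the exponent condition of [bump2_bound] hold *)
pose M := (Num.trunc (3 / (sigma - 1))).+1.
have MP : M.+3%:R <= M.+1%:R * sigma.
  have : 3 / (sigma - 1) < M%:R by apply: truncnS_gt.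
  rewrite ltr_pdivrMr ?subr_gt0// => H.
  rewrite -(@natr1 _ M.+2) -(@natr1 _ M.+1) -(@natr1 _ M); nra.
exists (M.+3%:R * (9 * M.+2%:R + 6)); first by rewrite mulr_gt0// addr_gt0// mulr_gt0.
move=> T T0; have T0n : T != 0 by rewrite gt_eqF.
have dT (f f' : R -> R) : (forall s : R, is_derive s 1 f (f' s)) ->
    forall c t : R, is_derive t 1 (fun t => c * f (t / T)) (c / T * f' (t / T)).
  move=> ff' c t.
  have ds : is_derive t 1 (fun t : R => t / T) T^-1.
    have H := is_deriveZ T^-1 (is_derive_id t 1).
    have -> : (fun t : R => t / T) = T^-1 *: id by apply/funext => x; rewrite mulrC.
    by refine (is_derive_eq H _); rewrite -[_ *: _]/(_ * _) mulr1.
  have := is_deriveZ c (@is_derive1_comp _ f (fun s => s / T) _ _ _ (ff' _) ds).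
  rewrite -[_ *: _]/(_ * _) => H.
  by refine (is_derive_eq (f := fun t : R => c * f (t / T)) H _); ring.
have cT (f : R -> R) (c : R) : continuous f -> continuous (fun t : R => c * f (t / T)).
  move=> cf t; apply: cvgM; first exact: cvg_cst.
  apply: (@continuous_comp _ _ _ (fun t : R => t / T) f); last exact: cf.
  by apply: cvgM; [exact: cvg_id|exact: cvg_cst].
exists (fun t => bump M (t / T)), (fun t => T^-1 * bump1 M (t / T)),
  (fun t => T ^- 2 * bump2 M (t / T)); split.
- apply: is_derive_halfline => t; have := dT _ _ (is_derive_bump M) 1 t.
  by rewrite div1r (_ : (fun t => 1 * _) = fun t => bump M (t / T))//; apply/funext => x; rewrite mul1r.
- apply: is_derive_halfline => t; have := dT _ _ (is_derive_bump1 M) T^-1 t.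
  by rewrite -invfM -expr2.
- have := cT _ 1 (@outer_continuous R M.+3 3).
  by rewrite (_ : (fun t => 1 * _) = fun t => bump M (t / T))//; apply/funext => x; rewrite mul1r.
- exact: cT _ _ (@bump2_continuous R M).
- by move=> t; exact: bump_ge0.
- by move=> t; exact: bump_le1.
- by move=> t tT; rewrite bump_eq1// ler_pdivrMr// mul1r.
- by move=> t tT; rewrite bump_eq0// ler_pdivlMr.
- by rewrite mul0r bump1_eq0 ?mulr0.
- by move=> t tT; rewrite bump2_eq0 ?mulr0// ler_pdivrMr// mul1r.
- by move=> t tT; rewrite bump2_eq0r ?mulr0// ler_pdivlMr.
- move=> t; rewrite normrM gtr0_norm ?invr_gt0 ?exprn_gt0//.
  by rewrite [leLHS]mulrC [leRHS]mulrAC ler_pM2r ?invr_gt0 ?exprn_gt0//; exact: bump2_bound.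
Qed.

(** * Lebesgue integrals in time *)

Section integration.
Context {R : realType}.
Local Notation LT := (lebesgueType R).
Implicit Types (s : R) (g : R -> R).

(** The integral of a nonnegative function is a supremum over the simple
    functions below it, hence monotone even without measurability. This allows
    infinite sums over the vertices to be compared with finite ones directly. *)
Lemma le_integral_nonmeasurable d (T : measurableType d)
    (mu : {measure set T -> \bar R}) (D : set T) (f g : T -> \bar R) :
  (forall t, D t -> 0 <= f t)%E -> (forall t, D t -> f t <= g t)%E ->
  (\int[mu]_(t in D) f t <= \int[mu]_(t in D) g t)%E.
Proof.
move=> f0 fg; have g0 t : D t -> (0 <= g t)%E.
  by move=> Dt; apply: le_trans (f0 _ Dt) (fg _ Dt).
rewrite !ge0_integralE//; apply: le_ereal_sup => _ [h hf <-]; exists h => // t.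
apply: le_trans (hf t) _; rewrite /patch; case: ifPn => // /set_mem Dt.
exact: fg.
Qed.

Lemma lebesgue_measurable_itv (i : interval R) : measurable ([set` i] : set LT).
Proof. by apply: sub_caratheodory; exact: measurable_itv. Qed.

Lemma lebesgue_measurable_continuous (D : set LT) g :
  continuous g -> measurable_fun D (g : LT -> R).
Proof.
move=> cg; apply: measurable_funTS => _ B mB; rewrite setTI.
apply: sub_caratheodory.
have := continuous_measurable_fun cg.
by move=> /(_ measurableT _ mB); rewrite setTI.
Qed.

Lemma integrable_mul_bounded (D : set LT) (f g : LT -> R) (K : R) :
  measurable D -> measurable_fun D g ->
  (forall t, D t -> `|g t| <= K) ->
  (@leb R).-integrable D (EFin \o f) ->
  (@leb R).-integrable D (EFin \o (fun t => f t * g t)).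
Proof.
move=> mD mg gK intf.
have mf : measurable_fun D f by apply/measurable_EFinP; exact: measurable_int intf.
apply: (@le_integrable _ _ _ _ _ mD _ (fun t => (K%:E * (f t)%:E)%E)).
- by apply/measurable_EFinP; exact: measurable_funM.
- move=> t Dt; rewrite /= lee_fin !normrM mulrC ler_wpM2r//.
  by apply: le_trans (gK _ Dt) _; exact: ler_norm.
- exact: integrableZl.
Qed.

Lemma Rintegral_sum d (T : measurableType d) (mu : {measure set T -> \bar R})
    (D : set T) (I : Type) (r : seq I) (f : I -> T -> R) :
  measurable D -> (forall i, mu.-integrable D (EFin \o f i)) ->
  (\int[mu]_(t in D) (\sum_(i <- r) f i t)) =
  \sum_(i <- r) (\int[mu]_(t in D) f i t).
Proof.
move=> mD intf; elim: r => [|i r IH].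
  rewrite big_nil (_ : (fun t => _) = cst 0) ?Rintegral_cst ?mul0r//.
  by apply/funext => t; rewrite big_nil.
rewrite big_cons -IH -RintegralD//.
  by congr Rintegral; apply/funext => t; rewrite big_cons.
have := @integrable_sum _ _ _ mu _ mD _ r xpredT (fun i => EFin \o f i) (fun i _ => intf i).
by apply: eq_integrable => // t _; rewrite /= sumEFin.
Qed.

(** Local integrability of the [w x] suffices, because [g] is bounded and
    vanishes beyond [s]. *)
Lemma Rintegral_halfline_sum (I : choiceType) (G : {fset I}) (w : I -> R -> R)
    (c : I -> R) g (K s : R) :
  0 < s -> continuous g -> (forall t, `|g t| <= K) ->
  (forall t, s <= t -> g t = 0) ->
  (forall x, (@leb R).-integrable `[0, s] (fun t => (w x t)%:E)) ->
  (\int[leb]_(t in `[0, +oo[) (\sum_(x <- G) w x t * g t * c x)) =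
  \sum_(x <- G) c x * (\int[leb]_(t in `[0, s]) (w x t * g t)).
Proof.
move=> s0 cg gK gs iw.
have iwg x : (@leb R).-integrable (`[0, s] : set LT) (EFin \o (fun t => w x t * g t)).
  apply: (integrable_mul_bounded _ _ (fun t _ => gK t)) (iw x).
    exact: lebesgue_measurable_itv.
  exact: lebesgue_measurable_continuous.
transitivity (\int[leb]_(t in `[0, s]) (\sum_(x <- G) w x t * g t * c x) : R).
  rewrite [LHS]Rintegral_mkcond [RHS]Rintegral_mkcond.
  apply: eq_Rintegral => t _; rewrite /patch !mem_setE !in_itv /= andbT.
  have [//|/ltW st] := leP t s; first by rewrite andbT.
  rewrite andbF; case: ifP => // _.
  by rewrite big1// => x _; rewrite gs ?mulr0 ?mul0r.
have mI := lebesgue_measurable_itv `[0, s].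
rewrite Rintegral_sum//.
  by apply: eq_bigr => x _; rewrite mulrC RintegralZr.
move=> x; have := integrableZr mI (c x) (iwg x).
by apply: eq_integrable => // t _; rewrite /= EFinM.
Qed.

End integration.

Section reaction_integral.
Context {R : realType}.
Local Notation LT := (lebesgueType R).
Variables (f th : R -> R) (T : R).
Hypothesis f_ge0 : forall t, 0 <= t -> 0 <= f t.
Hypothesis f_int : forall s, 0 < s -> (@leb R).-integrable `[0, s] (EFin \o f).
Hypothesis T_gt0 : 0 < T.
Hypotheses (th_cont : continuous th) (th_itv : forall t, 0 <= th t <= 1).
Hypothesis th_eq1 : forall t, t <= T -> th t = 1.
Implicit Types (a b s t : R).

Lemma le_Rintegral_subset (E E' : set LT) (g : R -> R) :
  measurable E -> measurable E' -> E `<=` E' -> (forall t, E' t -> 0 <= g t) ->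
  (@leb R).-integrable E' (EFin \o g) ->
  (\int[leb]_(t in E) g t) <= \int[leb]_(t in E') g t.
Proof.
move=> mE mE' EE' g0 ig.
have igE : (@leb R).-integrable E (EFin \o g) by exact: integrableS ig.
apply: fine_le; [exact: integrable_fin_num|exact: integrable_fin_num|].
apply: (@ge0_subset_integral _ _ _ (@leb R) E E' mE mE' (EFin \o g) _ _ EE').
- exact: measurable_int ig.
- by move=> t /g0; rewrite lee_fin.
Qed.

Lemma integrable_cutoff (E : set LT) : measurable E ->
  (@leb R).-integrable E (EFin \o f) ->
  (@leb R).-integrable E (EFin \o (fun t => f t * th t)).
Proof.
move=> mE; apply: (integrable_mul_bounded (K := 1) mE).
  exact: lebesgue_measurable_continuous.
by move=> t _; case/andP: (th_itv t) => ? ?; rewrite ger0_norm.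
Qed.

Lemma Rintegral_cutoff_le (E : set LT) : measurable E -> E `<=` `[0, +oo[ ->
  (@leb R).-integrable E (EFin \o f) ->
  (\int[leb]_(t in E) (f t * th t)) <= \int[leb]_(t in E) f t.
Proof.
move=> mE E0 fi; apply: le_Rintegral => //; first exact: integrable_cutoff.
move=> t /E0 /=; rewrite in_itv/= andbT => t0.
by rewrite ler_piMr ?f_ge0//; case/andP: (th_itv t).
Qed.

Lemma le_Rintegral_cutoff t1 : t1 <= T ->
  (\int[leb]_(t in `[0, t1]) f t) <= \int[leb]_(t in `[0, 2 * T]) (f t * th t).
Proof.
move=> t1T; have T20 : 0 < 2 * T by rewrite mulr_gt0.
have -> : (\int[leb]_(t in `[0, t1]) f t) = (\int[leb]_(t in `[0, t1]) (f t * th t)).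
  apply: eq_Rintegral => t; rewrite mem_setE in_itv/= => /andP[_ tt1].
  by rewrite th_eq1 ?mulr1// (le_trans tt1).
apply: le_Rintegral_subset; try exact: lebesgue_measurable_itv.
- move=> t /=; rewrite !in_itv/= => /andP[-> tt1] /=.
  by have := T_gt0; lra.
- move=> t /=; rewrite in_itv/= => /andP[t0 _].
  by rewrite mulr_ge0 ?f_ge0//; case/andP: (th_itv t).
- by apply: integrable_cutoff; [exact: lebesgue_measurable_itv|exact: f_int].
Qed.

(** The strict inequality keeps the two time intervals disjoint. *)
Lemma Rintegral_cutoff_tail t1 : t1 < T ->
  (\int[leb]_(t in `[T, 2 * T]) (f t * th t)) <=
  (\int[leb]_(t in `[0, 2 * T]) f t) - (\int[leb]_(t in `[0, t1]) f t).
Proof.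
move=> t1T; have T0 := T_gt0; have T20 : 0 < 2 * T by rewrite mulr_gt0.
have m i := @lebesgue_measurable_itv R i.
have sub : `[T, 2 * T]%classic `<=` (`[0, 2 * T]%classic : set R).
  by move=> t /=; rewrite !in_itv/= => /andP[Tt ->]; rewrite andbT; lra.
have sub1 : `[0, t1]%classic `<=` (`[0, 2 * T]%classic : set R).
  by move=> t /=; rewrite !in_itv/= => /andP[-> ?] /=; lra.
have iT : (@leb R).-integrable `[T, 2 * T] (EFin \o f).
  by apply: integrableS (f_int T20).
rewrite lerBrDr; apply: (@le_trans _ _
   ((\int[leb]_(t in `[T, 2 * T]) f t) + (\int[leb]_(t in `[0, t1]) f t))).
  rewrite lerD2r; apply: Rintegral_cutoff_le => //.
  by move=> t /=; rewrite !in_itv/= andbT => /andP[Tt _]; lra.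
have iU : (@leb R).-integrable (`[T, 2 * T] `|` `[0, t1]) (EFin \o f).
  by apply: integrableS (f_int T20); [exact: m|exact: measurableU|rewrite subUset].
rewrite -Rintegral_setU//; last first.
  apply/disj_set2P; rewrite -subset0 => t [] /=; rewrite !in_itv/= => /andP[? _] /andP[_ ?]; lra.
apply: le_Rintegral_subset => //; first exact: measurableU.
- by rewrite subUset.
- by move=> t /=; rewrite in_itv/= => /andP[t0 _]; exact: f_ge0.
- exact: f_int.
Qed.

End reaction_integral.

(** * Young's inequality *)

Section young.
Context {R : realType}.
Implicit Types (b k lam v : R).
Variable sigma : R.
Hypothesis sigma_gt1 : 1 < sigma.

(** Either [k] is at most [lam * v * b ^ (sigma - 1)], and the first term on the
    right dominates; or [b] is at most a power of [k / (lam * v)], and the second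
    one does. *)
Lemma young_pointwise lam v b k : 0 < lam -> 0 < v -> 0 <= b -> 0 <= k ->
  k * b <= lam * (v * b `^ sigma)
    + lam `^ (- (sigma - 1)^-1) * k `^ (sigma / (sigma - 1)) * v `^ (- (sigma - 1)^-1).
Proof.
move=> lam0 v0 b0 k0; have s1 := sigma_gt1.
have s10 : 0 < sigma - 1 by lra.
set q := (sigma - 1)^-1; have q0 : 0 < q by rewrite invr_gt0.
have r1 : 0 <= lam * (v * b `^ sigma) by rewrite !mulr_ge0 ?powR_ge0// ltW.
have r2 : 0 <= lam `^ (- q) * k `^ (sigma * q) * v `^ (- q) by rewrite !mulr_ge0 ?powR_ge0.
have [->|bn] := eqVneq b 0; first by rewrite mulr0 addr_ge0// mulr_ge0 ?mulr_ge0 ?powR_ge0 ?ltW.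
have [->|kn] := eqVneq k 0; first by rewrite mul0r addr_ge0// !mulr_ge0 ?powR_ge0.
have {bn}b0 : 0 < b by rewrite lt_neqAle eq_sym bn.
have {kn}k0 : 0 < k by rewrite lt_neqAle eq_sym kn.
have [H|H] := leP k (lam * v * b `^ (sigma - 1)).
  have -> : b `^ sigma = b `^ (sigma - 1) * b.
    rewrite -[in LHS](subrK 1 sigma) [LHS]powRD ?(gt_eqF b0) ?implybT//.
    by rewrite powRr1// ltW.
  have := ler_wpM2r (ltW b0) H; rewrite !mulrA in r1 *; lra.
have hb : b <= (k / (lam * v)) `^ q.
  have -> : b = (b `^ (sigma - 1)) `^ q.
    by rewrite -powRrM mulfV ?gt_eqF// powRr1// ltW.
  rewrite ge0_ler_powR ?nnegrE ?powR_ge0 ?(ltW q0)//.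
    by rewrite divr_ge0 ?(ltW k0)// mulr_ge0// ltW.
  by rewrite ler_pdivlMr ?mulr_gt0// mulrC ltW.
have : k * b <= k * (k / (lam * v)) `^ q by rewrite ler_pM2l.
rewrite powRM ?(ltW k0) ?invr_ge0 ?mulr_ge0 ?(ltW lam0) ?(ltW v0)//.
rewrite -powR_inv1 ?mulr_ge0 ?(ltW lam0) ?(ltW v0)// -powRrM mulN1r.
rewrite powRM ?(ltW lam0) ?(ltW v0)//.
have -> : k `^ (sigma * q) = k * k `^ q.
  rewrite (_ : sigma * q = 1 + q); last by rewrite /q; field; lra.
  by rewrite powRD ?powRr1 ?(ltW k0)// (gt_eqF k0) implybT.
rewrite (_ : k * (k `^ q * (lam `^ (- q) * v `^ (- q))) = lam `^ (- q) * (k * k `^ q) * v `^ (- q)).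
  by lra.
by ring.
Qed.

End young.

Section young_integrated.
Context {R : realType}.
Local Notation LT := (lebesgueType R).
Variables (sigma : R) (u v th g : R -> R).
Hypothesis sigma_gt1 : 1 < sigma.
Implicit Types (a s lam k : R).

Lemma Rintegral_restrict a s : 0 <= a ->
  (forall t, 0 <= t -> t < a -> g t = 0) ->
  (\int[leb]_(t in `[0, s]) (u t * g t)) = (\int[leb]_(t in `[a, s]) (u t * g t)).
Proof.
move=> a0 g0; rewrite [LHS]Rintegral_mkcond [RHS]Rintegral_mkcond.
congr Rintegral; apply/funext => t; rewrite /patch !mem_setE !in_itv/=.
have [at_|ta] := leP a t; first by rewrite (le_trans a0 at_).
by case: ifP => // /andP[t0 _]; rewrite g0 ?mulr0.
Qed.

(** Young's inequality is applied to [th ^ sigma^-1 * |u|], whose power [sigma]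
    is [th * |u| ^ sigma]: this is where the bound of [g] by a power of the cutoff
    is needed. *)
Lemma young_integrated a s lam k : 0 <= a -> 0 < s -> 0 < lam -> 0 <= k ->
  (forall t, 0 <= t -> 0 < v t) -> continuous g -> continuous th ->
  (forall t, 0 <= th t <= 1) ->
  (forall t, 0 <= t -> t < a -> g t = 0) -> (forall t, `|g t| <= k * th t `^ sigma^-1) ->
  (@leb R).-integrable `[0, s] (EFin \o u) ->
  (@leb R).-integrable `[0, s] (EFin \o (fun t => `|u t| `^ sigma * v t)) ->
  (@leb R).-integrable `[a, s] (EFin \o (fun t => v t `^ (- (sigma - 1)^-1))) ->
  `|\int[leb]_(t in `[0, s]) (u t * g t)| <=
  lam * (\int[leb]_(t in `[a, s]) (`|u t| `^ sigma * v t * th t))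
  + lam `^ (- (sigma - 1)^-1) * k `^ (sigma / (sigma - 1)) *
    (\int[leb]_(t in `[a, s]) (v t `^ (- (sigma - 1)^-1))).
Proof.
move=> a0 s0 lam0 k0 v0 cg cth th01 ga gth iu iuv ivq.
have sigma0 : 0 < sigma by exact: lt_trans sigma_gt1.
rewrite (Rintegral_restrict _ a0)//.
set E : set LT := `[a, s]%classic.
have mE : measurable E by exact: lebesgue_measurable_itv.
have m0 : measurable (`[0, s]%classic : set LT) by exact: lebesgue_measurable_itv.
have ES : E `<=` `[0, s] by move=> t; rewrite /E /= !in_itv/= => /andP[at_ ->]; rewrite (le_trans a0 at_).
have iuE : (@leb R).-integrable E (EFin \o u) by exact: integrableS iu.
have iuvE : (@leb R).-integrable E (EFin \o (fun t => `|u t| `^ sigma * v t)).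
  exact: integrableS iuv.
have th1 t : th t `^ sigma^-1 <= 1.
  case/andP: (th01 t) => t0 t1; have [->|tn] := eqVneq (th t) 0.
    by rewrite powR0// invr_neq0// gt_eqF.
  rewrite -(powRr0 (th t)); apply: ger_powR; last by rewrite invr_ge0 ltW.
  by rewrite lt_neqAle eq_sym tn t0.
have iug : (@leb R).-integrable E (EFin \o (fun t => u t * g t)).
  apply: (integrable_mul_bounded (K := k) mE) iuE.
    exact: lebesgue_measurable_continuous.
  by move=> t _; apply: le_trans (gth t) _; rewrite ler_piMr.
have iuvth : (@leb R).-integrable E (EFin \o (fun t => `|u t| `^ sigma * v t * th t)).
  apply: (integrable_mul_bounded (K := 1) mE) iuvE.
    exact: lebesgue_measurable_continuous.
  by move=> t _; case/andP: (th01 t) => ? ?; rewrite ger0_norm.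
have i1 : (@leb R).-integrable E (EFin \o (fun t => lam * (`|u t| `^ sigma * v t * th t))).
  by have := integrableZl mE lam iuvth; apply: eq_integrable => // t _; rewrite /= EFinM.
set c := lam `^ _ * k `^ _.
have i2 : (@leb R).-integrable E (EFin \o (fun t => c * v t `^ (- (sigma - 1)^-1))).
  by have := integrableZl mE c ivq; apply: eq_integrable => // t _; rewrite /= EFinM.
apply: (le_trans (le_normr_Rintegral mE iug)).
rewrite -RintegralZl// -RintegralZl// -RintegralD//.
apply: le_Rintegral => //.
- by have := integrable_abse iug; apply: eq_integrable => // t _.
- by have := integrableD mE i1 i2; apply: eq_integrable => // t _; rewrite /= EFinD.
move=> t; rewrite /E /= in_itv/= => /andP[at_ _].
have vt : 0 < v t by apply: v0; exact: le_trans at_.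
case/andP: (th01 t) => tht _.
have := young_pointwise sigma_gt1 lam0 vt
  (mulr_ge0 (powR_ge0 (th t) sigma^-1) (normr_ge0 (u t))) k0.
rewrite powRM ?powR_ge0// -powRrM mulVf ?gt_eqF// powRr1// -/c.
rewrite (_ : v t * _ = `|u t| `^ sigma * v t * th t); last by ring.
apply: le_trans; rewrite normrM mulrA mulrC ler_wpM2r//.
Qed.

End young_integrated.

Section sums_under_the_integral.
Context {R : realType} {V : countType}.
Local Notation LT := (lebesgueType R).

Lemma ge_esum_fset (S : set V) (a : V -> R) (F : {fset V}) :
  (forall x, x \in F -> S x) ->
  ((\sum_(x <- F) a x)%:E <= \esum_(x in S) (a x)%:E)%E.
Proof.
move=> FS; apply: esum_ge; exists [set` F]; first by split=> // x /FS.
by rewrite -sumEFin fsbig_seq//.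
Qed.

(** A bound on the integral of an infinite sum is used only through finite
    subfamilies, for which sum and integral commute. *)
Lemma esum_integral_bound (S : set V) (E : set LT) (g : V -> R -> R) (C : R) :
  measurable E ->
  (forall x t, E t -> 0 <= g x t) ->
  (forall x, measurable_fun E (g x : LT -> R)) ->
  ((\int[leb]_(t in E) (\esum_(x in S) (g x t)%:E)) <= C%:E)%E ->
  (forall x, S x -> (@leb R).-integrable E (EFin \o g x)) /\
  (forall F : {fset V}, (forall x, x \in F -> S x) ->
     \sum_(x <- F) (\int[leb]_(t in E) g x t) <= C).
Proof.
move=> mE g0 mg gC.
have sumC (F : {fset V}) : (forall x, x \in F -> S x) ->
    ((\int[leb]_(t in E) (\sum_(x <- F) g x t)%:E) <= C%:E)%E.
  move=> FS; apply: le_trans gC; apply: le_integral_nonmeasurable.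
    by move=> t Et; rewrite lee_fin sumr_ge0// => x _; exact: g0.
  by move=> t Et; exact: ge_esum_fset.
have ig x : S x -> (@leb R).-integrable E (EFin \o g x).
  move=> Sx; apply/integrableP; split; first exact/measurable_EFinP.
  apply: (@le_lt_trans _ _ C%:E); last exact: ltry.
  apply: (le_trans _ (sumC [fset x]%fset _)); last by move=> y; rewrite inE => /eqP ->.
  apply: le_integral_nonmeasurable => // t Et.
  by rewrite big_seq_fset1 /= lee_fin ger0_norm// g0.
split => // F FS.
have H := @Rintegral_sum _ _ _ (@leb R) E V F (fun x t => if x \in F then g x t else 0) mE.
have iF x : (@leb R).-integrable E (EFin \o (fun t => if x \in F then g x t else 0)).
  by case: (boolP (x \in F)) => xF; [exact/ig/FS|exact: integrable0].
have {}H := H iF.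
rewrite big_seq in H.
have -> : \sum_(x <- F) (\int[leb]_(t in E) g x t) =
    (\int[leb]_(t in E) (\sum_(x <- F) g x t)).
  transitivity (\sum_(x <- F | x \in F) (\int[leb]_(t in E) (if x \in F then g x t else 0)) : R).
    by rewrite [LHS]big_seq; apply: eq_bigr => x ->.
  rewrite -H; congr Rintegral; apply/funext => t.
  by rewrite big_seq [RHS]big_seq; apply: eq_bigr => x ->.
rewrite -lee_fin; apply: le_trans (sumC F FS).
rewrite /Rintegral fineK//; apply: integrable_fin_num => //.
have := @integrable_sum _ _ _ (@leb R) _ mE _ F xpredT
  (fun x => EFin \o (fun t => if x \in F then g x t else 0)) (fun i _ => iF i).
apply: eq_integrable => // t _; rewrite /= sumEFin big_seq [in RHS]big_seq.
by congr EFin; apply: eq_bigr => x ->.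
Qed.

End sums_under_the_integral.

(** * Exponential weights in space *)

Section ramp.
Context {R : realType}.
Implicit Types (r a b z : R).

(** A convex function with slope growing from 0 to 1 on [0, 1]: its derivative is
    Lipschitz, so that Taylor remainders are quadratic. *)
Definition ramp r : R :=
  if r <= 0 then 0 else if r <= 1 then r ^+ 2 / 2 else r - 2^-1.

Definition ramp' r : R := if r <= 0 then 0 else if r <= 1 then r else 1.

Lemma ramp'_itv r : 0 <= ramp' r <= 1.
Proof. by rewrite /ramp'; case: (leP r 0); case: (leP r 1) => ? ?; lra. Qed.

Lemma ramp_eq0 r : r <= 0 -> ramp r = 0.
Proof. by rewrite /ramp => ->. Qed.

Lemma ramp_ge0 r : 0 <= ramp r.
Proof. by rewrite /ramp; case: (leP r 0); case: (leP r 1) => ? ?; nra. Qed.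

Lemma ramp_ge r : r - 2^-1 <= ramp r.
Proof. by rewrite /ramp; case: (leP r 0); case: (leP r 1) => ? ?; nra. Qed.

Lemma ramp_lipschitz a b : `|ramp b - ramp a| <= `|b - a|.
Proof.
wlog ab : a b / a <= b.
  move=> H; have [ab|/ltW ab] := leP a b; first exact: H.
  by rewrite distrC [leRHS]distrC; exact: H.
have -> : `|b - a| = b - a by rewrite ger0_norm ?subr_ge0.
rewrite ler_norml.
rewrite /ramp; case: (leP a 0); case: (leP a 1); case: (leP b 0);
  case: (leP b 1) => ? ? ? ?; apply/andP; split; nra.
Qed.

Lemma ramp_taylor a b :
  `|ramp b - ramp a - ramp' a * (b - a)| <= (b - a) ^+ 2 / 2.
Proof.
have := sqr_ge0 a; have := sqr_ge0 b; have := sqr_ge0 (a - 1).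
have := sqr_ge0 (b - 1); have := sqr_ge0 (b - a).
rewrite !expr2 ler_norml /ramp /ramp'; case: (leP a 0); case: (leP a 1);
  case: (leP b 0); case: (leP b 1) => b1 b0 a1 a0 *; apply/andP; split; nra.
Qed.

Lemma expR_taylor z : `|expR z - 1 - z| <= z ^+ 2 * expR `|z|.
Proof.
have le1 (y : R) : expR y - 1 <= y * expR y.
  have := expR_ge1Dx (- y); rewrite expRN => H.
  have e0 := expR_gt0 y.
  have : (1 - y) * expR y <= (expR y)^-1 * expR y by rewrite ler_wpM2r// ltW.
  by rewrite mulVf ?gt_eqF//; nra.
rewrite ger0_norm; last by have := expR_ge1Dx z; lra.
have h1 : expR z - 1 - z <= z * (expR z - 1) by have := le1 z; nra.
apply: le_trans h1 _.
have [z0|z0] := leP 0 z.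
  by rewrite ger0_norm//; have := le1 z; nra.
rewrite ltr0_norm//.
have := expR_ge1Dx z.
have : 1 <= expR (- z) by rewrite -expR0 ler_expR; lra.
nra.
Qed.

End ramp.

Section spatial_weight.
Context {R : realType}.
Implicit Types (a b s r n J : R).
Variable delta : R.
Hypothesis delta_gt0 : 0 < delta.

(** The first ramp gives a weight equal to 1 up to distance [2 s] and decaying like
    [expR (- delta * r / s)]; the second one restores, from distance [n] on, the
    rate [delta] at which the solution is known to be summable. *)
Definition weight s n r : R :=
  expR (- (delta * (ramp (r / s - 2) + ramp (r - n)))).

Lemma weight_gt0 s n r : 0 < weight s n r. Proof. exact: expR_gt0. Qed.

Lemma weight_le1 s n r : weight s n r <= 1.
Proof.
by rewrite expR_le1 oppr_le0 mulr_ge0 ?(ltW delta_gt0)// addr_ge0// ramp_ge0.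
Qed.

Lemma weight_eq1 s n r : 0 < s -> r <= 2 * s -> r <= n -> weight s n r = 1.
Proof.
move=> s0 rs rn; rewrite /weight !ramp_eq0 ?addr0 ?mulr0 ?oppr0 ?expR0//.
  by rewrite subr_le0.
by rewrite subr_le0 ler_pdivrMr.
Qed.

Lemma weight_le_scale s n r :
  weight s n r <= expR (delta * (5 / 2)) * expR (- (delta * (r / s))).
Proof.
rewrite -expRD ler_expR -!mulrN -mulrDr ler_pM2l//.
by have := ramp_ge (r / s - 2); have := ramp_ge0 (r - n); lra.
Qed.

Lemma weight_le_tail s n r :
  weight s n r <= expR (delta * (n + 2^-1)) * expR (- (delta * r)).
Proof.
rewrite -expRD ler_expR -!mulrN -mulrDr ler_pM2l//.
by have := ramp_ge (r - n); have := ramp_ge0 (r / s - 2); lra.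
Qed.

Lemma ramp_scale_lipschitz s a b J : 1 <= s -> `|b - a| <= J ->
  `|ramp (b / s - 2) - ramp (a / s - 2)| <= J / s.
Proof.
move=> s1 abJ; apply: (le_trans (ramp_lipschitz _ _)).
have s0 : 0 < s by lra.
rewrite (_ : _ - _ = (b - a) / s); last by ring.
by rewrite normrM (gtr0_norm (x := s^-1)) ?invr_gt0// ler_pM2r ?invr_gt0.
Qed.

Lemma weight_ratio s n a b J : 1 <= s -> 0 <= J -> `|b - a| <= J ->
  weight s n b <= expR (2 * delta * J) * weight s n a.
Proof.
move=> s1 J0 abJ; rewrite -expRD ler_expR.
have h1 := ramp_scale_lipschitz s1 abJ.
have h2 : `|ramp (b - n) - ramp (a - n)| <= J.
  by apply: (le_trans (ramp_lipschitz _ _)); rewrite opprB addrA subrK.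
have h3 : J / s <= J by rewrite ler_pdivrMr; nra.
rewrite (_ : 2 * delta * J = delta * (2 * J)); last by ring.
rewrite -!mulrN -mulrDr ler_pM2l//.
move: h1 h2; rewrite !ler_norml => /andP[h1 _] /andP[h2 _]; lra.
Qed.

(** Below distance [n] only the slow ramp is active, and each derivative of it
    brings a factor [s^-1]. *)
Lemma weight_taylor s n a b J : 1 <= s -> 0 <= J -> `|b - a| <= J ->
  a <= n -> b <= n ->
  `|weight s n b - weight s n a
    - - (weight s n a * delta * ramp' (a / s - 2) / s) * (b - a)| <=
  weight s n a * ((delta * J ^+ 2 / 2 + delta ^+ 2 * J ^+ 2 * expR (delta * J))
                  / s ^+ 2).
Proof.
move=> s1 J0 abJ an bn; have s0 : 0 < s by lra.
have wE r : r <= n -> weight s n r = expR (- (delta * ramp (r / s - 2))).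
  by move=> rn; rewrite /weight (@ramp_eq0 _ (r - n)) ?subr_le0// addr0.
set z := - (delta * (ramp (b / s - 2) - ramp (a / s - 2))).
have wb : weight s n b = weight s n a * expR z.
  by rewrite !wE// -expRD /z; congr expR; ring.
set w := weight s n a in wb *; have w0 : 0 < w by exact: weight_gt0.
rewrite wb.
set q := ramp' (a / s - 2).
(* the error splits into that of the exponential and that of the ramp *)
rewrite (_ : _ - _ = w * ((expR z - 1 - z) + (z + delta * (q * ((b - a) / s))))); last first.
  by ring.
rewrite normrM gtr0_norm// ler_pM2l// (le_trans (ler_normD _ _))//.
have h1 := ramp_scale_lipschitz s1 abJ.
have zJ : `|z| <= delta * J / s.
  by rewrite normrN normrM gtr0_norm// -mulrA ler_pM2l.
have zJ1 : `|z| <= delta * J.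
  by apply: le_trans zJ _; rewrite ler_pdivrMr// ler_peMr// mulr_ge0// ltW.
rewrite [leRHS]mulrDl [leLHS]addrC lerD//.
- have := ramp_taylor (a / s - 2) (b / s - 2).
  rewrite -/q (_ : b / s - 2 - (a / s - 2) = (b - a) / s); last by ring.
  move=> H; rewrite (_ : z + _ = - (delta * (ramp (b / s - 2) - ramp (a / s - 2) - q * ((b - a) / s)))); last first.
    by rewrite /z; ring.
  rewrite normrN normrM gtr0_norm//.
  rewrite (_ : _ / s ^+ 2 = delta * ((J / s) ^+ 2 / 2)); last by rewrite -exprVn; ring.
  rewrite ler_pM2l//; apply: le_trans H _; rewrite ler_pM2r//.
  rewrite -[leLHS]real_normK ?num_real// lerXn2r ?nnegrE ?divr_ge0// ?(ltW s0)//.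
  by rewrite normrM (gtr0_norm (x := s^-1)) ?invr_gt0// ler_pM2r ?invr_gt0.
- apply: le_trans (expR_taylor z) _.
  rewrite (_ : _ / s ^+ 2 = (delta * J / s) ^+ 2 * expR (delta * J)); last first.
    by rewrite -exprVn; ring.
  apply: ler_pM; rewrite ?sqr_ge0 ?expR_ge0 ?ler_expR//.
  rewrite -[leLHS]real_normK ?num_real// lerXn2r ?nnegrE ?divr_ge0//.
    by rewrite mulr_ge0// ltW.
  exact: ltW.
Qed.

End spatial_weight.

(** * The Laplacian on finite sets *)

Section graph_laplacian.
Context {R : realType} {V : countType}.
Variables (omega : V -> V -> R) (mu : V -> R).
Hypothesis graph : weighted_graph omega mu.
Hypothesis locfin : locally_finite_graph omega.
Implicit Types (f g : V -> R) (x y : V).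

Definition nbhd x : {fset V} := fset_set (neighbors omega x).

Lemma in_nbhd x y : (y \in nbhd x) = (0 < omega x y).
Proof. by rewrite in_fset_set; [rewrite mem_setE|exact: locfin]. Qed.

Lemma laplacianE f x :
  laplacian omega mu f x = (mu x)^-1 * \sum_(y <- nbhd x) omega x y * (f y - f x).
Proof. by rewrite /laplacian fsbig_finite//; exact: locfin. Qed.

Lemma laplacian_mul f x :
  laplacian omega mu f x * mu x = \sum_(y <- nbhd x) omega x y * (f y - f x).
Proof.
by rewrite laplacianE mulrC mulVKf// gt_eqF//; exact: vertex_weight_gt0 graph x.
Qed.

Lemma omega_eq0 x y : y \notin nbhd x -> omega x y = 0.
Proof.
rewrite in_nbhd -leNgt => xy; apply/eqP; rewrite eq_le xy/=.
exact: edge_weight_ge0 graph x y.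
Qed.

Lemma degree_le (C : R) x :
  ((\esum_(y in neighbors omega x) (omega x y)%:E) <= (C * mu x)%:E)%E ->
  \sum_(y <- nbhd x) omega x y <= C * mu x.
Proof.
rewrite esum_fset; [|exact: locfin|by move=> y _; rewrite lee_fin; exact: edge_weight_ge0 graph x y].
by rewrite fsbig_finite; [rewrite sumEFin lee_fin|exact: locfin].
Qed.

(** A first order chain rule: when the increments of [f] at [x] are those of
    [c * g] up to an error [K], so are the Laplacians, the total conductance
    being at most [C * mu x]. *)
Lemma laplacian_near_linear (C K c : R) f g x :
  \sum_(y <- nbhd x) omega x y <= C * mu x ->
  (forall y, 0 < omega x y -> `|f y - f x - c * (g y - g x)| <= K) ->
  0 <= K ->
  `|laplacian omega mu f x - c * laplacian omega mu g x| <= C * K.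
Proof.
move=> deg fgK K0; have mu0 : 0 < mu x by exact: vertex_weight_gt0 graph x.
rewrite !laplacianE mulrCA -mulrBr normrM gtr0_norm ?invr_gt0// mulrC ler_pdivrMr//.
rewrite mulr_sumr -sumrB (le_trans (ler_norm_sum _ _ _))//.
apply: (@le_trans _ _ (\sum_(y <- nbhd x) omega x y * K)); last first.
  by rewrite -mulr_suml mulrAC ler_wpM2r.
rewrite big_seq [leRHS]big_seq; apply: ler_sum => y; rewrite in_nbhd => xy.
rewrite (_ : _ - _ = omega x y * (f y - f x - c * (g y - g x))); last by ring.
by rewrite normrM gtr0_norm// ler_pM2l// fgK.
Qed.

Lemma sum_fset_widen (A B : {fset V}) (a : V -> R) :
  (forall y, y \in A -> y \notin B -> a y = 0) ->
  (forall y, y \in B -> y \notin A -> a y = 0) ->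
  \sum_(y <- A) a y = \sum_(y <- B) a y.
Proof.
move=> AB BA.
have H (G H : {fset V}) : (forall y, y \in G -> y \notin H -> a y = 0) ->
    \sum_(y <- G) a y = \sum_(y <- (G `&` H)%fset) a y.
  move=> GH; apply/esym/big_fset_incl; first exact: fsubsetIl.
  by move=> y yG; rewrite in_fsetI yG/= => /(GH _ yG).
by rewrite (H A B AB) (H B A BA) fsetIC.
Qed.

(** Discrete Green formula: over a finite set containing the support of [g] and
    its neighbours, both sides are double sums, exchanged by the symmetry of
    [omega]. *)
Lemma laplacian_symmetric (F N : {fset V}) f g :
  (forall x, x \notin F -> g x = 0) ->
  (F `<=` N)%fset -> (forall x y, x \in F -> y \in nbhd x -> y \in N) ->
  \sum_(x <- F) laplacian omega mu f x * g x * mu x =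
  \sum_(x <- N) f x * laplacian omega mu g x * mu x.
Proof.
move=> gF /fsubsetP FN nN.
transitivity (\sum_(x <- N) \sum_(y <- N) omega x y * (f y - f x) * g x).
  rewrite (@sum_fset_widen F N); last 2 first.
  - by move=> x /FN ->.
  - by move=> x _ /gF ->; rewrite mulr0 mul0r.
  apply: eq_bigr => x _; rewrite mulrAC laplacian_mul.
  have [xF|/gF ->] := boolP (x \in F); last first.
    by rewrite mulr0 big1// => y _; rewrite mulr0.
  rewrite mulr_suml (@sum_fset_widen (nbhd x) N)//.
  - by move=> y /(nN _ _ xF) ->.
  - by move=> y _ /omega_eq0 ->; rewrite !mul0r.
transitivity (\sum_(x <- N) \sum_(y <- N) omega x y * (g y - g x) * f x); last first.
  apply: eq_bigr => x _; rewrite -mulrA laplacian_mul mulr_sumr.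
  rewrite [RHS](@sum_fset_widen (nbhd x) N); first by apply: eq_bigr => y _; rewrite mulrC.
  - move=> y yx yN; have [/nN/(_ yx)|xF] := boolP (x \in F); first by rewrite (negbTE yN).
    rewrite (gF x)// (gF y) ?subr0 ?mulr0//.
    by apply: contra yN => /FN.
  - by move=> y _ /omega_eq0 ->; rewrite mul0r mulr0.
have split h k : \sum_(x <- N) \sum_(y <- N) omega x y * (h y - h x) * k x =
    \sum_(x <- N) \sum_(y <- N) omega x y * h y * k x -
    \sum_(x <- N) \sum_(y <- N) omega x y * h x * k x.
  rewrite -sumrB; apply: eq_bigr => x _; rewrite -sumrB; apply: eq_bigr => y _.
  by rewrite mulrBr mulrBl.
rewrite !split; congr (_ - _).
  rewrite exchange_big/=; apply: eq_bigr => y _; apply: eq_bigr => x _.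
  by rewrite (edge_weight_sym graph x y) mulrAC.
by apply: eq_bigr => x _; apply: eq_bigr => y _; rewrite mulrAC.
Qed.

End graph_laplacian.

(** * Finite sums *)

Section finite_sums.
Context {R : realType} {V : choiceType}.
Implicit Types (a b : V -> R) (F G : {fset V}).

Lemma sup_approx (I : Type) (i0 : I) (h : I -> R) (M : R) :
  (forall i, h i <= M) ->
  forall e, 0 < e -> exists i, forall j, h j <= h i + e.
Proof.
move=> hM e e0; pose E := range h.
have supE : has_sup E.
  by split; [exists (h i0), i0|exists M => _ [i _ <-]].
have [_ [i _ <-] hi] := sup_adherent e0 supE.
exists i => j; have : h j <= sup E by apply: ub_le_sup; [case: supE|exists j].
lra.
Qed.

Lemma sum_fset_sub a F G : (F `<=` G)%fset ->
  \sum_(x <- F) a x = \sum_(x <- G | x \in F) a x.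
Proof.
move=> FG; rewrite [RHS]big_mkcond.
transitivity (\sum_(x <- F) if x \in F then a x else 0).
  by rewrite big_seq [RHS]big_seq; apply: eq_bigr => x ->.
by apply: big_fset_incl => // x _ /negbTE ->.
Qed.

Lemma ler_sum_fset a F G : (F `<=` G)%fset -> (forall x, 0 <= a x) ->
  \sum_(x <- F) a x <= \sum_(x <- G) a x.
Proof.
move=> FG a0; rewrite (sum_fset_sub _ FG) big_mkcond.
by apply: ler_sum => x _; case: ifP.
Qed.

(** Outside a finite set that nearly exhausts the sum of [a], no finite sum can
    exceed the missing amount. *)
Lemma sum_fset_tail a (M : R) : (forall x, 0 <= a x) ->
  (forall F, \sum_(x <- F) a x <= M) ->
  forall e, 0 < e -> exists G, forall F, \sum_(x <- F | x \notin G) a x <= e.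
Proof.
move=> a0 aM e e0; have [G GP] := sup_approx fset0 aM e0.
exists G => F; have := GP (F `|` G)%fset.
rewrite (bigID (fun x => x \in G))/= -(sum_fset_sub _ (fsubsetUr _ _)) lerD2l.
apply: le_trans; rewrite big_mkcond [leRHS]big_mkcond/=.
by apply: ler_sum_fset; [exact: fsubsetUl|move=> x; case: ifP].
Qed.

Lemma ler_sum_fset_in a b F : (forall x, x \in F -> a x <= b x) ->
  \sum_(x <- F) a x <= \sum_(x <- F) b x.
Proof.
by move=> ab; rewrite big_seq [leRHS]big_seq; apply: ler_sum => x /ab.
Qed.

End finite_sums.

(** * The Laplacian of a truncated weight *)

Section truncated_weight.
Context {R : realType} {V : countType}.
Variables (omega : V -> V -> R) (mu : V -> R).
Hypothesis graph : weighted_graph omega mu.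
Hypothesis locfin : locally_finite_graph omega.
Variables (D : V -> R) (J C0 C1 R0 alpha delta : R).
Hypothesis delta_gt0 : 0 < delta.
Hypothesis degree_bound : forall x, \sum_(y <- nbhd omega x) omega x y <= C0 * mu x.
Hypothesis jump_bound : forall x y, 0 < omega x y -> `|D y - D x| <= J.
Hypothesis R0_gt1 : 1 < R0.
Hypothesis alpha_itv : 0 <= alpha <= 1.
Hypotheses (J_ge0 : 0 <= J) (C0_gt0 : 0 < C0) (C1_gt0 : 0 < C1).
Hypothesis laplacian_distance : forall x, R0 <= D x ->
  `|laplacian omega mu D x| <= C1 / (D x `^ alpha).
Implicit Types (F : {fset V}) (s n : R) (x y : V).

Definition trunc_weight F s n x : R :=
  if x \in F then weight delta s n (D x) else 0.

(** [far_const] bounds the Laplacian of the truncated weight relative to the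
    weight everywhere, [near_const] its coefficient of [s ^ (- (1 + alpha))] where
    only the slow ramp is active. *)
Definition far_const : R := C0 * (1 + expR (2 * delta * J)).
Definition near_const : R :=
  delta * C1 + C0 * (delta * J ^+ 2 / 2 + delta ^+ 2 * J ^+ 2 * expR (delta * J)).

Lemma far_const_gt0 : 0 < far_const.
Proof. by rewrite mulr_gt0// addr_gt0// expR_gt0. Qed.

Lemma near_const_gt0 : 0 < near_const.
Proof.
rewrite ltr_pwDl ?mulr_gt0// mulr_ge0 ?(ltW C0_gt0)//.
have d0 := ltW delta_gt0.
by rewrite addr_ge0 ?mulr_ge0 ?exprn_ge0 ?expR_ge0.
Qed.

(** One jump changes the weight by a bounded factor only, whether or not it
    leaves the truncation set. *)
Lemma laplacian_trunc_weight_far F s n x : 1 <= s ->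
  `|laplacian omega mu (trunc_weight F s n) x| <= weight delta s n (D x) * far_const.
Proof.
move=> s1; have w0 y : 0 < weight delta s n (D y) by exact: weight_gt0.
have t y : 0 <= trunc_weight F s n y <= weight delta s n (D y).
  by rewrite /trunc_weight; case: ifP => _; rewrite ?lexx ltW.
have := @laplacian_near_linear _ _ _ _ graph locfin C0
  (weight delta s n (D x) * (1 + expR (2 * delta * J))) 0
  (trunc_weight F s n) D x (degree_bound x).
rewrite mul0r subr0 /far_const mulrCA; apply => [y xy|]; last first.
  by rewrite mulr_ge0 ?addr_ge0 ?expR_ge0// ltW.
rewrite mul0r subr0.
have h := weight_ratio delta_gt0 n s1 J_ge0 (jump_bound xy).
have := t x; have := t y; rewrite ler_norml => /andP[? ?] /andP[? ?].
by apply/andP; split; lra.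
Qed.

(** All neighbours lie within distance [2 s], where the weight is constant. *)
Lemma laplacian_trunc_weight_flat F s n x : 1 <= s ->
  J <= s -> 2 * s <= n -> D x < s ->
  x \in F -> (forall y, y \in nbhd omega x -> y \in F) ->
  laplacian omega mu (trunc_weight F s n) x = 0.
Proof.
move=> s1 Js sn Dx xF nF; have s0 : 0 < s by lra.
have w1 y : y \in F -> D y <= 2 * s -> trunc_weight F s n y = 1.
  by move=> yF Dy; rewrite /trunc_weight yF weight_eq1//; lra.
rewrite (laplacianE _ locfin) big_seq big1 ?mulr0// => y yx.
rewrite !w1 ?subrr ?mulr0//; [lra|exact: nF|].
move: yx; rewrite in_nbhd// => /jump_bound; rewrite ler_norml => /andP[_]; lra.
Qed.

(** The linear part of the weight in the distance contributes
    [delta / s * |laplacian d| = O(s^-1 * s ^ (- alpha))], the quadratic remainder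
    [O(s ^- 2)], which is no larger since [alpha <= 1]. *)
Lemma laplacian_trunc_weight_near F s n x : R0 <= s -> s <= D x ->
  D x + J <= n -> x \in F -> (forall y, y \in nbhd omega x -> y \in F) ->
  `|laplacian omega mu (trunc_weight F s n) x| <=
  weight delta s n (D x) * (near_const * s `^ (- (1 + alpha))).
Proof.
move=> Rs sD Dn xF nF; have R1 := R0_gt1; have J0 := J_ge0; have s0 : 0 < s by lra.
have s1 : 1 <= s by lra.
set w := weight delta s n (D x); have w0 : 0 < w by exact: weight_gt0.
set q := ramp' (D x / s - 2); have q01 : 0 <= q <= 1 by exact: ramp'_itv.
set K := delta * J ^+ 2 / 2 + delta ^+ 2 * J ^+ 2 * expR (delta * J).
have K0 : 0 <= K.
  have d0 := ltW delta_gt0.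
  by rewrite addr_ge0 ?mulr_ge0 ?exprn_ge0 ?expR_ge0.
have := @laplacian_near_linear _ _ _ _ graph locfin C0 (w * (K / s ^+ 2))
  (- (w * delta * q / s)) (trunc_weight F s n) D x (degree_bound x).
move=> H.
have {}H : `|laplacian omega mu (trunc_weight F s n) x
            - - (w * delta * q / s) * laplacian omega mu D x| <= C0 * (w * (K / s ^+ 2)).
  apply: H => [y xy|]; last first.
    by rewrite mulr_ge0 ?(ltW w0)// divr_ge0// exprn_ge0// ltW.
  have yF : y \in F by apply: nF; rewrite in_nbhd.
  rewrite /trunc_weight xF yF; apply: weight_taylor => //; first exact: jump_bound.
    by lra.
  by have := jump_bound xy; rewrite ler_norml => /andP[_]; lra.
have s2 : (s ^+ 2)^-1 <= s `^ (- (1 + alpha)).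
  rewrite powRN lef_pV2 ?posrE ?powR_gt0 ?exprn_gt0//.
  rewrite -powR_mulrn ?(ltW s0)//; apply: ler_powR => //. case/andP: alpha_itv => a0 a1; lra.
have LD : s^-1 * `|laplacian omega mu D x| <= C1 * s `^ (- (1 + alpha)).
  have := laplacian_distance (le_trans Rs sD).
  move=> /(ler_wpM2l (ltW _ : 0 <= s^-1)) -/(_ _) /le_trans; apply; first by rewrite invr_gt0.
  rewrite powRN powRD ?(gt_eqF s0) ?implybT// powRr1 ?(ltW s0)// invfM.
  rewrite mulrCA ler_pM2l// ler_pM2l ?invr_gt0// lef_pV2 ?posrE ?powR_gt0//; last lra.
  by rewrite ge0_ler_powR ?nnegrE//; [case/andP: alpha_itv|lra|lra].
have {}H : `|laplacian omega mu (trunc_weight F s n) x| <=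
    C0 * (w * (K / s ^+ 2)) + w * delta * q * (s^-1 * `|laplacian omega mu D x|).
  apply: (@le_trans _ _ (_ + `|- (w * delta * q / s) * laplacian omega mu D x|)).
    rewrite -lerBlDr; apply: le_trans H; exact: lerB_dist.
  rewrite lerD2l mulNr normrN normrM ger0_norm ?mulrA// !mulr_ge0 ?(ltW w0) ?(ltW delta_gt0)//.
    by case/andP: q01.
  by rewrite invr_ge0 ltW.
apply: (le_trans H).
have e1 : C0 * (w * (K / s ^+ 2)) <= C0 * (w * (K * s `^ (- (1 + alpha)))).
  by rewrite ler_pM2l// ler_pM2l// ler_wpM2l.
have e2 : w * delta * q * (s^-1 * `|laplacian omega mu D x|) <=
          w * delta * (C1 * s `^ (- (1 + alpha))).
  apply: ler_pM => //.
  - by rewrite !mulr_ge0 ?(ltW w0) ?(ltW delta_gt0)//; case/andP: q01.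
  - by rewrite mulr_ge0// invr_ge0 ltW.
  - by rewrite ger_pMr ?mulr_gt0//; case/andP: q01.
apply: le_trans (lerD e1 e2) _; rewrite /near_const -/K le_eqVlt; apply/orP; left.
by apply/eqP; ring.
Qed.

End truncated_weight.

(** * Absorption at one spatial scale *)

Lemma fset_bounded {R : realType} {V : choiceType} (D : V -> R) (G : {fset V}) :
  exists r, forall x, x \in G -> D x <= r.
Proof.
suff [r rP] : exists r, forall x, x \in (G : seq V) -> D x <= r by exists r.
elim: (G : seq V) => [|y s [r IH]]; first by exists 0.
exists (Num.max (D y) r) => x; rewrite inE le_max => /predU1P[->|/IH ->].
  by rewrite lexx.
by rewrite orbT.
Qed.

Section absorption.
Context {R : realType} {V : countType}.
Variables (omega : V -> V -> R) (mu : V -> R).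
Hypothesis graph : weighted_graph omega mu.
Hypothesis locfin : locally_finite_graph omega.
Variables (D : V -> R) (J C0 C1 R0 alpha delta : R).
Hypothesis delta_gt0 : 0 < delta.
Hypothesis degree_bound : forall x, \sum_(y <- nbhd omega x) omega x y <= C0 * mu x.
Hypothesis jump_bound : forall x y, 0 < omega x y -> `|D y - D x| <= J.
Hypothesis R0_gt1 : 1 < R0.
Hypothesis alpha_itv : 0 <= alpha <= 1.
Hypotheses (J_ge0 : 0 <= J) (C0_gt0 : 0 < C0) (C1_gt0 : 0 < C1).
Hypothesis laplacian_distance : forall x, R0 <= D x ->
  `|laplacian omega mu D x| <= C1 / (D x `^ alpha).
Variable ball : R -> {fset V}.
Hypothesis in_ball : forall k x, (x \in ball k) = (D x < k).

Variables (s : R) (A A' U2 U0 W u1 : V -> R) (lam lam' p K3 Sw M : R).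
Hypotheses (R0s : R0 <= s) (Js : J <= s).
Hypotheses (A'_ge0 : forall x, 0 <= A' x) (U0_ge0 : forall x, 0 <= U0 x).
Hypothesis W_ge0 : forall x, 0 <= W x.
Hypotheses (lam_ge0 : 0 <= lam) (lam'_ge0 : 0 <= lam').
Local Notation rho := (s `^ (- (1 + alpha))).
Local Notation K1 := (far_const J C0 delta).
Local Notation K2 := (near_const J C0 C1 delta).

Hypothesis tested : forall (F N : {fset V}) (psi : V -> R),
  (forall x, 0 <= psi x) -> (forall x, x \notin F -> psi x = 0) ->
  (F `<=` N)%fset -> (forall x y, x \in F -> y \in nbhd omega x -> y \in N) ->
  \sum_(x <- F) psi x * mu x * A x <=
  \sum_(x <- F) psi x * mu x * U2 x
  + \sum_(x <- N) mu x * `|laplacian omega mu psi x| * U0 x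
  - \sum_(x <- F) u1 x * psi x * mu x.
Hypothesis young2 : forall x, U2 x <= lam * A' x + lam' * (K3 * rho) `^ p * W x.
Hypothesis young0 : forall x k, 0 <= k -> s <= D x ->
  k * U0 x <= lam * A' x + lam' * k `^ p * W x.
Hypothesis sumW : forall F : {fset V},
  \sum_(x <- F) W x * expR (- (delta * (D x / s))) * mu x <= Sw.
Hypothesis sumU0 : forall F : {fset V},
  \sum_(x <- F) U0 x * expR (- (delta * D x)) * mu x <= M.

Local Notation wW x := (W x * expR (- (delta * (D x / s))) * mu x).
Local Notation wU x := (U0 x * expR (- (delta * D x)) * mu x).
Local Notation cs := (expR (delta * (5 / 2))).

(** The argument at one spatial scale, freed from the integrals in time: [A] stands
    for the reaction integral against the cutoff, [A'] for its part over the times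
    where derivatives of the test function live, [U2] and [U0] for the integrals
    of the solution against the second derivative of the cutoff and the cutoff
    itself, [W] for the integral of the inverse power of [v]. The parameter [n] is
    chosen first, so that the bound [far_const] is only felt on a tail of the
    convergent sum of the [W x]; the truncation radius [k] is chosen next, so that
    the vertices near the boundary of the ball of radius [k] only see a tail of
    the sum of the [U0 x], which converges against [weight s n]. *)
Lemma weighted_absorption (F0 : {fset V}) (e : R) : 0 < e ->
  exists (F : {fset V}) (psi : V -> R),
  [/\ (F0 `<=` F)%fset, forall x, 0 <= psi x <= 1,
      forall x, D x < s -> psi x = 1 &
  \sum_(x <- F) psi x * mu x * A x <=
  2 * lam * (\sum_(x <- F) psi x * mu x * A' x)
  + lam' * ((K3 * rho) `^ p + (K2 * rho) `^ p) * cs * Sw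
  + e - \sum_(x <- F) u1 x * psi x * mu x].
Proof.
move=> e0.
have s1 : 1 < s by exact: lt_le_trans R0_gt1 R0s.
have s0 : 0 < s by lra.
have mu0 x : 0 < mu x by exact: vertex_weight_gt0 graph x.
have K10 : 0 < K1 by exact: far_const_gt0.
have K20 : 0 < K2 by exact: near_const_gt0.
have wW0 x : 0 <= wW x by rewrite !mulr_ge0 ?expR_ge0// ltW.
have wU0 x : 0 <= wU x by rewrite !mulr_ge0 ?expR_ge0// ltW.
have cs0 : 0 < cs by exact: expR_gt0.
pose c1 := lam' * K1 `^ p * cs.
have c10 : 0 <= c1 by rewrite !mulr_ge0 ?powR_ge0// ltW.
have c1p : 0 < 2 * (c1 + 1) by lra.
have [G1 G1P] := sum_fset_tail wW0 sumW (divr_gt0 e0 c1p).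
have [r1 r1P] := fset_bounded D G1.
pose n := Num.max (2 * s) (r1 + J + 1).
have n1 : 2 * s <= n by rewrite le_max lexx.
have n2 : r1 + J + 1 <= n by rewrite le_max lexx orbT.
pose c2 := K1 * expR (delta * (n + 2^-1)).
have c20 : 0 <= c2 by rewrite mulr_ge0 ?expR_ge0// ltW.
have c2p : 0 < 2 * (c2 + 1) by lra.
have [G2 G2P] := sum_fset_tail wU0 sumU0 (divr_gt0 e0 c2p).
have [r2 r2P] := fset_bounded D G2.
have [r0 r0P] := fset_bounded D F0.
pose k := Num.max (r2 + J + 1) (r0 + 1).
have k1 : r2 + J + 1 <= k by rewrite le_max lexx.
have k2 : r0 + 1 <= k by rewrite le_max lexx orbT.
pose F := ball k; pose N := ball (k + J).
pose psi x := weight delta s n (D x).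
have psi0 x : 0 < psi x by exact: weight_gt0.
have J0 := J_ge0.
have nN x y : x \in F -> y \in nbhd omega x -> y \in N.
  rewrite in_nbhd// !in_ball => xk /jump_bound; rewrite ler_norml => /andP[_ ?]; lra.
have FN : (F `<=` N)%fset by apply/fsubsetP => x; rewrite !in_ball; lra.
exists F, psi; split.
- by apply/fsubsetP => x /r0P xr; rewrite in_ball; lra.
- by move=> x; rewrite ltW//= weight_le1.
- by move=> x xs; rewrite /psi weight_eq1//; lra.
have hW x : psi x * mu x * W x <= cs * wW x.
  rewrite (_ : cs * wW x = cs * expR (- (delta * (D x / s))) * mu x * W x); last by ring.
  by rewrite ler_wpM2r// ler_pM2r//; exact: weight_le_scale.
have hU x : psi x * mu x * U0 x <= expR (delta * (n + 2^-1)) * wU x.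
  rewrite (_ : _ * wU x = expR (delta * (n + 2^-1)) * expR (- (delta * D x)) * mu x * U0 x); last by ring.
  by rewrite ler_wpM2r// ler_pM2r//; exact: weight_le_tail.
pose f := trunc_weight D delta F s n.
pose T x := mu x * `|laplacian omega mu f x| * U0 x.
pose b k := lam' * k `^ p * cs.
have b0 k' : 0 <= b k' by rewrite !mulr_ge0 ?powR_ge0// ltW.
have psiA0 x : 0 <= lam * (psi x * mu x * A' x).
  by rewrite !mulr_ge0// ltW.
(* the weight is comparable to the exponential against which [W] is summed *)
have weigh x k' X : X <= lam * A' x + lam' * k' `^ p * W x ->
    psi x * mu x * X <= lam * (psi x * mu x * A' x) + b k' * wW x.
  move=> XA; apply: (@le_trans _ _ (psi x * mu x * (lam * A' x + lam' * k' `^ p * W x))).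
    by rewrite ler_wpM2l// mulr_ge0// ltW.
  rewrite (_ : _ * (_ + _) = lam * (psi x * mu x * A' x)
      + lam' * k' `^ p * (psi x * mu x * W x)); last by ring.
  rewrite lerD2l /b -[leRHS]mulrA ler_wpM2l ?mulr_ge0 ?powR_ge0//; exact: hW.
have hT x k' : `|laplacian omega mu f x| <= psi x * k' -> T x <= psi x * mu x * (k' * U0 x).
  move=> H; rewrite /T (_ : psi x * mu x * _ = mu x * (psi x * k') * U0 x); last by ring.
  by rewrite ler_wpM2r// ler_pM2l.
have vertex x : x \in N ->
    (if x \in F then psi x * mu x * U2 x else 0) + T x <=
    (if x \in F then 2 * (lam * (psi x * mu x * A' x)) + (b (K3 * rho) + b (K2 * rho)) * wW x else 0)
    + (if x \notin G1 then c1 * wW x else 0) + (if x \notin G2 then c2 * wU x else 0).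
  move=> xN.
  have b1 : 0 <= b (K2 * rho) * wW x by exact: mulr_ge0.
  have b2 : 0 <= (if x \notin G1 then c1 * wW x else 0).
    by case: ifP => // _; exact: mulr_ge0.
  have b3 : 0 <= (if x \notin G2 then c2 * wU x else 0).
    by case: ifP => // _; exact: mulr_ge0.
  have a0 := psiA0 x.
  have y2 := weigh _ _ _ (young2 x).
  suff : T x <= (if x \in F then lam * (psi x * mu x * A' x) + b (K2 * rho) * wW x else 0)
    + (if x \notin G1 then c1 * wW x else 0) + (if x \notin G2 then c2 * wU x else 0).
    by case: ifP => _ ?; lra.
  have far := laplacian_trunc_weight_far graph locfin delta_gt0 degree_bound
    jump_bound J_ge0 F n x (ltW s1).
  (* next to the truncation boundary, summability of the solution takes over *)
  have [xk|xk] := leP (k - J) (D x).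
    have -> : x \notin G2 by apply/negP => /r2P; lra.
    have h1 : T x <= c2 * wU x.
      apply: le_trans (hT _ _ far) _.
      by rewrite [leLHS]mulrCA /c2 -[leRHS]mulrA ler_pM2l.
    by case: (x \in F); lra.
  have xF : x \in F by rewrite in_ball; lra.
  have nF y : y \in nbhd omega x -> y \in F.
    by rewrite in_nbhd// in_ball => /jump_bound; rewrite ler_norml => /andP[_ ?]; lra.
  rewrite xF; have [xs|xs] := ltP (D x) s.
    rewrite /T (laplacian_trunc_weight_flat mu locfin delta jump_bound (ltW s1) Js n1 xs xF nF).
    by rewrite normr0 mulr0 mul0r; lra.
  have [xn|xn] := leP (D x + J) n.
    have near := laplacian_trunc_weight_near graph locfin delta_gt0 degree_bound
      jump_bound R0_gt1 alpha_itv J_ge0 C0_gt0 C1_gt0 laplacian_distance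
      R0s xs xn xF nF.
    have k0 : 0 <= K2 * rho by rewrite mulr_ge0 ?powR_ge0// ltW.
    have := weigh _ _ _ (young0 k0 xs).
    by have := hT _ _ near; lra.
  (* near and beyond distance [n], only a tail of the sum of [W] is left *)
  have -> : x \notin G1 by apply/negP => /r1P; lra.
  have := weigh _ _ _ (young0 (ltW K10) xs).
  by have := hT _ _ far; rewrite (_ : b K1 = c1)//; lra.
have f0 x : 0 <= f x by rewrite /f /trunc_weight; case: ifP => // _; exact/ltW/weight_gt0.
have fF x : x \notin F -> f x = 0 by rewrite /f /trunc_weight => /negbTE ->.
have fE x : x \in F -> f x = psi x by rewrite /f /trunc_weight => ->.
have eqF (g h : V -> R) : (forall x, x \in F -> g x = h x) ->
    \sum_(x <- F) g x = \sum_(x <- F) h x.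
  by move=> gh; rewrite big_seq [RHS]big_seq; apply: eq_bigr => x /gh.
have := tested f0 fF FN nN.
rewrite (eqF _ (fun x => psi x * mu x * A x)); last by move=> x /fE ->.
rewrite (eqF (fun x => f x * mu x * U2 x) (fun x => psi x * mu x * U2 x)); last by move=> x /fE ->.
rewrite (eqF (fun x => u1 x * _ * _) (fun x => u1 x * psi x * mu x)); last by move=> x /fE ->.
have := ler_sum_fset_in vertex.
rewrite !big_split/= -!big_mkcond/= -!(sum_fset_sub _ FN).
rewrite big_split/= -!mulr_sumr.
have := G1P N; have := G2P N.
rewrite !ler_pdivlMr//.
have := sumW F.
set S1 := \sum_(x <- F) _; set S2 := \sum_(x <- N | _) _; set S3 := \sum_(x <- N | _) _.
move=> h1 h2 h3 h4 h5.
have h6 : (b (K3 * rho) + b (K2 * rho)) * S1 <= (b (K3 * rho) + b (K2 * rho)) * Sw.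
  by rewrite ler_wpM2l// addr_ge0.
have S20 : 0 <= S2 by apply: sumr_ge0.
have S30 : 0 <= S3 by apply: sumr_ge0.
have -> : lam' * ((K3 * rho) `^ p + (K2 * rho) `^ p) * cs * Sw =
   (b (K3 * rho) + b (K2 * rho)) * Sw by rewrite /b; ring.
lra.
Qed.

End absorption.

(** * Testing the inequality *)

Section tested_inequality.
Context {R : realType} {V : countType}.
Implicit Types (f : R -> R) (t : R).

Lemma halfline_derivativeZ (c : R) f (f' : R -> R) :
  halfline_derivative f f' ->
  halfline_derivative (fun t => c * f t) (fun t => c * f' t).
Proof.
move=> ff' t t0; rewrite (_ : (fun s => _) = fun s => c * ((f s - f t) / (s - t))).
  by apply: cvgM; [exact: cvg_cst|exact: ff'].
by apply/funext => s; rewrite -mulrBr mulrA.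
Qed.

Variables (omega : V -> V -> R) (mu : V -> R) (v u : V -> R -> R) (u0 u1 : V -> R).
Variables (sigma K T : R) (th th1 th2 : R -> R).
Hypothesis graph : weighted_graph omega mu.
Hypothesis locfin : locally_finite_graph omega.
Hypothesis sol : very_weak_solution omega mu v sigma u0 u1 u.
Hypotheses (sigma_gt0 : 0 < sigma) (K_ge0 : 0 <= K) (T_gt0 : 0 < T).
Hypothesis cutoff : time_cutoff sigma K T th th1 th2.

Lemma cutoff2_bounded t : `|th2 t| <= K * T ^- 2.
Proof.
apply: le_trans (tc_bound cutoff t) _; rewrite ler_piMr//.
  by rewrite mulr_ge0// invr_ge0 exprn_ge0// ltW.
rewrite -(powRr0 (th t)) ; have [->|t0] := eqVneq (th t) 0.
  by rewrite powR0 ?invr_neq0 ?gt_eqF// powRr0.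
apply: ger_powR; last by rewrite invr_ge0 ltW.
by rewrite lt_neqAle eq_sym t0 (tc_ge0 cutoff) (tc_le1 cutoff).
Qed.

Lemma cutoff_norm_le1 t : `|th t| <= 1.
Proof. by rewrite ger0_norm ?(tc_ge0 cutoff) ?(tc_le1 cutoff). Qed.

(** For a product test function the space-time integrals decouple into finite
    sums over the vertices of integrals in time, the Laplacian being moved onto
    [psi] by the Green formula; the initial datum disappears because the cutoff
    is constant near time 0. *)
Lemma tested_inequality (F N : {fset V}) (psi : V -> R) :
  (forall x, 0 <= psi x) -> (forall x, x \notin F -> psi x = 0) ->
  (F `<=` N)%fset -> (forall x y, x \in F -> y \in nbhd omega x -> y \in N) ->
  \sum_(x <- F) psi x * mu x *
    (\int[leb]_(t in `[0, 2 * T]) (`|u x t| `^ sigma * v x t * th t)) <=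
  \sum_(x <- F) psi x * mu x * `|\int[leb]_(t in `[0, 2 * T]) (u x t * th2 t)|
  + \sum_(x <- N) mu x * `|laplacian omega mu psi x| *
      `|\int[leb]_(t in `[0, 2 * T]) (u x t * th t)|
  - \sum_(x <- F) u1 x * psi x * mu x.
Proof.
move=> psi0 psiF FN nN; have T20 : 0 < 2 * T by rewrite mulr_gt0.
have mu0 x : 0 < mu x by exact: vertex_weight_gt0 graph x.
have test : test_function (fun x t => psi x * th t) (fun x t => psi x * th1 t)
    (fun x t => psi x * th2 t).
  split.
  - by move=> x t _; rewrite mulr_ge0// (tc_ge0 cutoff).
  - exists [set` F], (2 * T); split => // x t _ H; split.
      by apply: contraNT H => /psiF ->; rewrite mul0r.
    by apply: contraNT H; rewrite -ltNge => /ltW /(tc_eq0 cutoff) ->; rewrite mulr0.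
  - move=> x; split.
    + exact: halfline_derivativeZ (tc_derive cutoff).
    + exact: halfline_derivativeZ (tc_derive1 cutoff).
    + apply: continuous_subspaceT => t; apply: cvgM; first exact: cvg_cst.
      exact: (tc_continuous2 cutoff).
have sumF (w : V -> R -> R) (g : R -> R) (B : R) : continuous g ->
    (forall t, `|g t| <= B) -> (forall t, 2 * T <= t -> g t = 0) ->
    (forall x, (@leb R).-integrable `[0, 2 * T] (fun t => (w x t)%:E)) ->
    (\int[leb]_(t in `[0, +oo[) (\sum_(x \in [set: V]) (w x t * (psi x * g t) * mu x))) =
    \sum_(x <- F) psi x * mu x * (\int[leb]_(t in `[0, 2 * T]) (w x t * g t)).
  move=> cg gB g0 iw.
  rewrite -(Rintegral_halfline_sum F (fun x => psi x * mu x) T20 cg gB g0 iw).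
  congr Rintegral; apply/funext => t.
  rewrite (fsbigTE F) => [|x /psiF ->]; last by rewrite mul0r mulr0 mul0r.
  by apply: eq_bigr => x _; ring.
have iu x := vws_L1loc sol x T20.
have iv x := vws_Lsigmaloc sol x T20.
have := vws_ineq sol test.
rewrite (sumF _ _ _ (tc_continuous2 cutoff) cutoff2_bounded (tc_eq02r cutoff) iu).
have -> : (\int[leb]_(t in `[0, +oo[) (\sum_(x \in [set: V])
      (laplacian omega mu (u^~ t) x * (psi x * th t) * mu x))) =
    \sum_(x <- N) laplacian omega mu psi x * mu x *
      (\int[leb]_(t in `[0, 2 * T]) (u x t * th t)).
  rewrite -(Rintegral_halfline_sum N (fun x => laplacian omega mu psi x * mu x) T20
     (tc_continuous cutoff) cutoff_norm_le1 (tc_eq0 cutoff) iu).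
  congr Rintegral; apply/funext => t.
  rewrite (fsbigTE F) => [|x /psiF ->]; last by rewrite mul0r mulr0 mul0r.
  have := laplacian_symmetric graph locfin (u^~ t) psiF FN nN.
  move=> /(congr1 (fun z => z * th t)); rewrite !mulr_suml => H.
  rewrite [LHS](_ : _ = \sum_(x <- F) laplacian omega mu (u^~ t) x * psi x * mu x * th t).
    by rewrite H; apply: eq_bigr => x _; ring.
  by apply: eq_bigr => x _; ring.
rewrite [X in _ + X - _](_ : _ = 0); last first.
  by rewrite fsbig1// => x _; rewrite (tc_init cutoff) !mulr0 mul0r.
rewrite addr0.
have -> : \sum_(x \in [set: V]) (u1 x * (psi x * th 0) * mu x) =
    \sum_(x <- F) u1 x * psi x * mu x.
  rewrite (fsbigTE F) => [|x /psiF ->]; last by rewrite mul0r mulr0 mul0r.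
  by apply: eq_bigr => x _; rewrite (tc_eq1 cutoff) ?mulr1// ltW.
have -> : (\int[leb]_(t in `[0, +oo[) (\sum_(x \in [set: V])
      (v x t * `|u x t| `^ sigma * (psi x * th t) * mu x))) =
    \sum_(x <- F) psi x * mu x *
      (\int[leb]_(t in `[0, 2 * T]) (`|u x t| `^ sigma * v x t * th t)).
  rewrite -(sumF _ _ _ (tc_continuous cutoff) cutoff_norm_le1 (tc_eq0 cutoff) iv).
  congr Rintegral; apply/funext => t; apply: eq_fsbigr => x _.
  by rewrite [v x t * _]mulrC.
move/le_trans; apply; rewrite lerB// lerD//.
- by apply: ler_sum => x _; rewrite ler_wpM2l ?ler_norm// mulr_ge0// ltW.
- rewrite -sumrN; apply: ler_sum => x _; apply: le_trans (ler_norm _) _.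
  by rewrite normrN !normrM (gtr0_norm (mu0 x)) [_ * mu x]mulrC.
Qed.

End tested_inequality.

(** * The estimate at scale s *)

Section scale_estimate.
Context {R : realType} {V : countType}.
Local Notation LT := (lebesgueType R).
Variables (omega : V -> V -> R) (mu : V -> R) (d : V -> V -> R) (x0 : V)
  (R0 alpha : R) (v : V -> R -> R) (sigma delta : R)
  (u : V -> R -> R) (u0 u1 : V -> R).
Hypothesis hgraph : weighted_graph omega mu.
Hypothesis hA' : assumptionA' omega mu d x0 R0 alpha.
Hypothesis hvmeas : forall x,
  measurable_fun (`[0, +oo[ : set (lebesgueType R)) (v x).
Hypothesis hvpos : forall x (t : R), 0 <= t -> 0 < v x t.
Hypotheses (hsigma : 1 < sigma) (hdelta : 0 < delta).
Hypothesis hu : very_weak_solution omega mu v sigma u0 u1 u.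
Hypothesis huX : L1loc_X mu d x0 delta u.
Variable C : R.
Hypothesis C_gt0 : 0 < C.
Hypothesis hv : forall r : R, R0 <= r ->
      ((\int[leb]_(t in `[(r `^ ((1 + alpha) / 2))%R,
                         (2 * r `^ ((1 + alpha) / 2))%R])
         (\esum_(x in dball d x0 r)
           (v x t `^ (- (sigma - 1)^-1) * expR (- (delta * (d x x0 / r)))
              * mu x)%:E))
       <= (C * r `^ ((alpha + 1) * sigma / (sigma - 1)))%:E)%E /\
      ((\int[leb]_(t in `[0%R, (2 * r `^ ((1 + alpha) / 2))%R])
         (\esum_(x in ~` dball d x0 r)
           (v x t `^ (- (sigma - 1)^-1) * expR (- (delta * (d x x0 / r)))
              * mu x)%:E))
       <= (C * r `^ ((alpha + 1) * sigma / (sigma - 1)))%:E)%E.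

Definition reaction x (s : R) : R :=
  \int[leb]_(t in `[0, s]) (`|u x t| `^ sigma * v x t).

Local Notation q := ((sigma - 1)^-1).
Local Notation D x := (d x x0).

Lemma exists_jump_bound : exists2 J : R, 0 <= J &
  forall x y, 0 < omega x y -> `|D y - D x| <= J.
Proof.
have pm := A'_pseudo_metric hA'; have := A'_jump_size hA'.
set j := jump_size omega d => j_fin.
exists (Num.max 0 (fine j)); first by rewrite le_max lexx.
move=> x y xy; have dj : ((d x y)%:E <= j)%E.
  by apply: ereal_sup_ubound; exists (x, y).
have jf : j \is a fin_num.
  by rewrite fin_numElt j_fin andbT; apply: lt_le_trans dj; exact: ltNyr.
rewrite le_max; apply/orP; right; rewrite -lee_fin fineK//.
apply: le_trans dj; rewrite lee_fin ler_norml.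
have := pseudo_metric_triangle pm x y x0; have := pseudo_metric_triangle pm y x x0.
by rewrite (pseudo_metric_sym pm y x) => ? ?; apply/andP; split; lra.
Qed.

Lemma finite_ball r : finite_set (dball d x0 r).
Proof.
have [r0|r0] := ltP 0 r; first exact: A'_finite_balls hA' x0 _ r0.
rewrite (_ : dball d x0 r = set0)//; apply/seteqP; split => // x /=.
rewrite /dball /= ltNge => /negP; apply; apply: (le_trans r0).
exact: pseudo_metric_ge0 (A'_pseudo_metric hA') _ _.
Qed.

Lemma dballE r x : dball d x0 r x = (D x < r).
Proof. by rewrite /dball /= (pseudo_metric_sym (A'_pseudo_metric hA')). Qed.

Lemma measurable_inverse_power x (E : set LT) : measurable E -> E `<=` `[0, +oo[ ->
  measurable_fun E (fun t : LT => v x t `^ (- q)).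
Proof.
move=> mE E0; apply: (measurableT_comp (measurable_powR _)).
by apply: measurable_funS (hvmeas x) => //; exact: lebesgue_measurable_itv.
Qed.

(** Inside the ball only the times after [T] matter, outside of it all of them do:
    the lower endpoint [a x] lets the two volume growth hypotheses be used as
    one. *)
Lemma volume_growth (s : R) (T := s `^ ((1 + alpha) / 2))
    (a := fun x => if D x < s then T else 0) : R0 <= s ->
  (forall x, (@leb R).-integrable `[a x, 2 * T] (EFin \o (fun t => v x t `^ (- q)))) /\
  (forall F : {fset V},
    \sum_(x <- F) (\int[leb]_(t in `[a x, 2 * T]) (v x t `^ (- q)))
      * expR (- (delta * (D x / s))) * mu x
    <= 2 * C * s `^ ((alpha + 1) * sigma / (sigma - 1))).
Proof.
move=> R0s; have R1 := A'_R0 hA'; have s0 : 0 < s by lra.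
have T0 : 0 < T by exact: powR_gt0.
have [h1 h2] := hv R0s; rewrite -/T in h1 h2.
pose g x t := v x t `^ (- q) * expR (- (delta * (D x / s))) * mu x.
have mu0 x : 0 < mu x by exact: vertex_weight_gt0 hgraph x.
have g0 x t : 0 <= g x t by rewrite !mulr_ge0 ?powR_ge0 ?expR_ge0// ltW.
have mg (E : set LT) : measurable E -> E `<=` `[0, +oo[ ->
    forall x, measurable_fun E (g x : LT -> R).
  move=> mE E0 x; apply: measurable_funM; last exact: measurable_cst.
  apply: measurable_funM; last exact: measurable_cst.
  exact: measurable_inverse_power.
have m i := @lebesgue_measurable_itv R i.
have E1 : (`[T, 2 * T]%classic : set R) `<=` `[0, +oo[.
  by move=> t /=; rewrite !in_itv/= andbT => /andP[+ _]; apply: le_trans; exact: ltW.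
have E2 : (`[0, 2 * T]%classic : set R) `<=` `[0, +oo[.
  by move=> t /=; rewrite !in_itv/= andbT => /andP[].
have [i1 s1] := esum_integral_bound (m _) (fun x t _ => g0 x t) (mg _ (m _) E1) h1.
have [i2 s2] := esum_integral_bound (m _) (fun x t _ => g0 x t) (mg _ (m _) E2) h2.
pose c x := expR (- (delta * (D x / s))) * mu x.
have c0 x : 0 < c x by rewrite mulr_gt0 ?expR_gt0.
have gE x t : v x t `^ (- q) = (c x)^-1 * g x t.
  by rewrite /g -mulrA -/(c x) mulrC mulfK// gt_eqF.
have ivq x : (@leb R).-integrable `[a x, 2 * T] (EFin \o (fun t => v x t `^ (- q))).
  have igx : (@leb R).-integrable `[a x, 2 * T] (EFin \o g x).
    rewrite /a; case: ifPn => Dx; first by apply: i1; rewrite dballE.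
    by apply: i2 => /=; rewrite dballE; exact/negP.
  have := integrableZl (m _) (c x)^-1 igx; apply: eq_integrable => // t _.
  by rewrite /= gE EFinM.
split=> // F.
have IE x : (\int[leb]_(t in `[a x, 2 * T]) (v x t `^ (- q)))
      * expR (- (delta * (D x / s))) * mu x = \int[leb]_(t in `[a x, 2 * T]) g x t.
  rewrite -mulrA -/(c x) -RintegralZr//; apply: eq_Rintegral => t _.
  by rewrite /g -mulrA.
under eq_bigr do rewrite IE.
rewrite (bigID (fun x => D x < s))/= -[leRHS]mulrA [leRHS]mulr_natl mulr2n; apply: lerD.
- apply: le_trans (s1 [fset x in F | D x < s]%fset _); last first.
    by move=> x; rewrite !inE/= => /andP[_]; rewrite dballE.
  rewrite le_eqVlt; apply/orP; left; apply/eqP.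
  rewrite -big_fset_condE/=; apply: eq_bigr => x Dx.
  by rewrite /a Dx.
- apply: le_trans (s2 [fset x in F | ~~ (D x < s)]%fset _); last first.
    by move=> x; rewrite !inE/= => /andP[_ H]; rewrite dballE; exact/negP.
  rewrite le_eqVlt; apply/orP; left; apply/eqP.
  rewrite -big_fset_condE/=; apply: eq_bigr => x Dx.
  by rewrite /a (negbTE Dx).
Qed.

Lemma weighted_L1_bound (s : R) : 0 < s -> exists M, forall F : {fset V},
  \sum_(x <- F) (\int[leb]_(t in `[0, s]) `|u x t|)
    * expR (- (delta * D x)) * mu x <= M.
Proof.
move=> s0; have := huX s0; set I := (\int[leb]_(t in _) _)%E => I_fin.
have mu0 x : 0 < mu x by exact: vertex_weight_gt0 hgraph x.
have m0 := @lebesgue_measurable_itv R `[0, s].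
have iu x := vws_L1loc hu x s0.
have mu_ x : measurable_fun (`[0, s] : set LT) (u x).
  by apply/measurable_EFinP; case/integrableP: (iu x).
pose g x t := `|u x t| * expR (- (delta * D x)) * mu x.
have g0 x t : 0 <= g x t by rewrite !mulr_ge0 ?expR_ge0// ltW.
have I0 : (0 <= I)%E.
  apply: integral_ge0 => t _; apply: esum_ge0 => x _; rewrite lee_fin; exact: g0.
have If : I \is a fin_num by rewrite ge0_fin_numE.
have mg x : measurable_fun (`[0, s] : set LT) (g x).
  apply: measurable_funM; last exact: measurable_cst.
  apply: measurable_funM; last exact: measurable_cst.
  exact: measurableT_comp.
have Ib : (\int[leb]_(t in `[0%R, s]) (\esum_(x in [set: V]) (g x t)%:E) <= (fine I)%:E)%E.
  by rewrite fineK.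
have [_ sg] := esum_integral_bound m0 (fun x t _ => g0 x t) mg Ib.
exists (fine I) => F; apply: le_trans (sg F _); last by [].
rewrite le_eqVlt; apply/orP; left; apply/eqP; apply: eq_bigr => x _.
have iux : (@leb R).-integrable `[0, s] (EFin \o (fun t => `|u x t|)).
  by have := integrable_abse (iu x); apply: eq_integrable => // t _.
rewrite -mulrA -RintegralZr//; apply: eq_Rintegral => t _.
by rewrite /g -mulrA.
Qed.

(** At scale [s], with [T ^ 2 = s ^ (1 + alpha)], both the second time derivative of
    the cutoff and the Laplacian of the weight are [O(s ^ (- (1 + alpha)))], and the
    power [sigma / (sigma - 1)] of this cancels the volume growth: this is why [Kc]
    does not depend on [s]. The bounds on [A] and [A'] are all that is remembered of
    the time cutoff. *)
Lemma scale_estimate : exists Kc s0 : R, 0 < Kc /\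
  forall (s lam e : R) (F0 : {fset V}) (T := s `^ ((1 + alpha) / 2)),
  s0 <= s -> 0 < lam -> 0 < e ->
  exists (F : {fset V}) (psi A A' : V -> R),
  [/\ [/\ (F0 `<=` F)%fset, forall x, 0 <= psi x <= 1 & forall x, D x < s -> psi x = 1],
      [/\ forall x (t1 : R), t1 <= T -> reaction x t1 <= A x, forall x, 0 <= A' x <= A x,
       forall x, A x <= reaction x (2 * T) &
       forall x (t1 : R), D x < s -> t1 < T ->
         A' x <= reaction x (2 * T) - reaction x t1] &
  \sum_(x <- F) psi x * mu x * A x <=
  2 * lam * (\sum_(x <- F) psi x * mu x * A' x) + lam `^ (- q) * Kc
  + e - \sum_(x <- F) u1 x * psi x * mu x].
Proof.
have s1 := hsigma; have sigma0 : 0 < sigma by lra.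
have d0 := hdelta; have R1 := A'_R0 hA'.
have locfin := A'_locally_finite hA'.
have [C0 C00 deg] := A'_degree hA'.
have {}deg x := degree_le hgraph locfin (deg x).
have [J J0 jump] := exists_jump_bound.
have [C1 C10 LD] := A'_laplacian_distance hA'.
have {}LD x : R0 <= D x -> `|laplacian omega mu (fun y => D y) x| <= C1 / (D x `^ alpha).
  by move=> Dx; apply: LD; rewrite dballE; apply/negP; rewrite -leNgt.
have [K3 K30 cutoff] := exists_time_cutoff hsigma.
pose p := sigma / (sigma - 1).
pose K2 := near_const J C0 C1 delta.
have K20 : 0 < K2 by exact: near_const_gt0.
pose cs := expR (delta * (5 / 2)).
pose Kc := (K3 `^ p + K2 `^ p) * cs * (2 * C).
exists Kc, (Num.max R0 J); split.
  by rewrite !mulr_gt0 ?expR_gt0// addr_gt0// powR_gt0.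
move=> s lam e F0 T; rewrite ge_max => /andP[R0s Js] lam0 e0.
have s0 : 0 < s by lra.
have T0 : 0 < T by exact: powR_gt0.
have T20 : 0 < 2 * T by rewrite mulr_gt0.
have [th [th1 [th2 tc]]] := cutoff _ T0.
pose rho := s `^ (- (1 + alpha)).
have rho0 : 0 <= rho by exact: powR_ge0.
have T2 : T ^- 2 = rho.
  by rewrite /rho powRN -powR_mulrn ?(ltW T0)// -powRrM divfK.
pose a x := if D x < s then T else 0.
have a0 x : 0 <= a x by rewrite /a; case: ifP => // _; exact: ltW.
have [iW sW] := volume_growth R0s; rewrite -/T in iW sW.
have [M sM] := weighted_L1_bound T20.
pose I x (E : set LT) := \int[leb]_(t in E) (`|u x t| `^ sigma * v x t * th t).
pose A x := I x `[0, 2 * T]%classic.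
pose A' x := I x `[a x, 2 * T]%classic.
pose W x := \int[leb]_(t in `[a x, 2 * T]) (v x t `^ (- q)).
pose U2 x := `|\int[leb]_(t in `[0, 2 * T]) (u x t * th2 t)|.
pose U0 x := `|\int[leb]_(t in `[0, 2 * T]) (u x t * th t)|.
have th01 t : 0 <= th t <= 1 by rewrite (tc_ge0 tc) (tc_le1 tc).
have thc := tc_continuous tc.
have m i := @lebesgue_measurable_itv R i.
have iu x := vws_L1loc hu x T20.
have iv x := vws_Lsigmaloc hu x T20.
have f0 x t : 0 <= t -> 0 <= `|u x t| `^ sigma * v x t.
  by move=> t0; rewrite mulr_ge0 ?powR_ge0// ltW// hvpos.
have sub x : (`[a x, 2 * T]%classic : set R) `<=` `[0, 2 * T].
  by move=> t /=; rewrite !in_itv/= => /andP[at_ ->]; rewrite (le_trans (a0 x) at_).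
have A'0 x : 0 <= A' x.
  apply: Rintegral_ge0 => t /sub /=; rewrite in_itv/= => /andP[t0 _].
  by rewrite mulr_ge0 ?f0//; case/andP: (th01 t).
have A'A x : A' x <= A x.
  apply: le_Rintegral_subset; [exact: m|exact: m|exact: sub| |].
  - move=> t /=; rewrite in_itv/= => /andP[t0 _].
    by rewrite mulr_ge0 ?f0//; case/andP: (th01 t).
  - apply: integrable_cutoff => //; exact: iv.
have tested := tested_inequality hgraph locfin hu sigma0 (ltW K30) T0 tc.
have y2 x : U2 x <= lam * A' x + lam `^ (- q) * (K3 * rho) `^ p * W x.
  apply: young_integrated => //.
  - by rewrite mulr_ge0// ltW.
  - exact: hvpos.
  - exact: tc_continuous2 tc.
  - move=> t _ ta; apply: (tc_eq02 tc); apply: le_trans (ltW ta) _.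
    by rewrite /a; case: ifP => // _; exact: ltW.
  - by move=> t; rewrite -T2; exact: (tc_bound tc).
  - exact: iu.
  - exact: iv.
  - exact: iW.
have iuth x : (@leb R).-integrable `[0, 2 * T] (EFin \o (fun t => u x t * th t)).
  apply: (integrable_mul_bounded (K := 1) (m _)) (iu x).
    exact: lebesgue_measurable_continuous.
  by move=> t _; case/andP: (th01 t) => ? ?; rewrite ger0_norm.
have y0 x k : 0 <= k -> s <= D x -> k * U0 x <= lam * A' x + lam `^ (- q) * k `^ p * W x.
  move=> k0 sD; have ax : a x = 0 by rewrite /a ltNge sD.
  have -> : k * U0 x = `|\int[leb]_(t in `[0, 2 * T]) (u x t * (k * th t))|.
    rewrite /U0 -[in LHS](ger0_norm k0) -normrM -RintegralZl//; congr (`|_|).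
    by apply: eq_Rintegral => t _; ring.
  apply: young_integrated => //.
  - exact: hvpos.
  - by move=> t; apply: cvgM; [exact: cvg_cst|exact: thc].
  - by rewrite ax => t /le_lt_trans /[apply]; rewrite ltxx.
  - move=> t; case/andP: (th01 t) => t0 t1; rewrite normrM !ger0_norm// ler_wpM2l//.
    have [->|tn] := eqVneq (th t) 0; first exact: powR_ge0.
    rewrite -[leLHS](powRr1 t0); apply: ger_powR; last by rewrite invf_le1// ltW.
    by rewrite lt_neqAle eq_sym tn t0.
  - exact: iu.
  - exact: iv.
  - exact: iW.
have sU0 (F : {fset V}) : \sum_(x <- F) U0 x * expR (- (delta * D x)) * mu x <= M.
  apply: le_trans (sM F); apply: ler_sum => x _.
  rewrite -!mulrA ler_wpM2r//.
    by rewrite mulr_ge0 ?expR_ge0// ltW//; exact: vertex_weight_gt0 hgraph x.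
  apply: le_trans (le_normr_Rintegral (m _) (iuth x)) _; apply: le_Rintegral => //.
  - by have := integrable_abse (iuth x); apply: eq_integrable => // t _.
  - by have := integrable_abse (iu x); apply: eq_integrable => // t _.
  - move=> t _; case/andP: (th01 t) => ? ?.
    by rewrite normrM (ger0_norm (x := th t))// ler_piMr.
have W0 x : 0 <= W x by apply: Rintegral_ge0 => t _; exact: powR_ge0.
have in_ball r x : (x \in fset_set (dball d x0 r)) = (D x < r).
  rewrite in_fset_set; last exact: finite_ball.
  by apply/idP/idP => [/set_mem|H]; [|apply/mem_set]; rewrite dballE.
have [F [psi [F0F psi01 psi1 est]]] := weighted_absorption hgraph locfin hdelta deg
  jump R1 (A'_alpha hA') J0 C00 C10 LD
  (ball := fun r => fset_set (dball d x0 r))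
  in_ball
  R0s Js A'0 (fun x => normr_ge0 _) W0 (ltW lam0) (powR_ge0 lam (- q))
  tested y2 y0 sW sU0 F0 e0.
have ivs x s' : 0 < s' ->
    (@leb R).-integrable `[0, s'] (EFin \o (fun t => `|u x t| `^ sigma * v x t)).
  by move=> s'0; exact: vws_Lsigmaloc hu x s' s'0.
have th1E t : t <= T -> th t = 1 by exact: (tc_eq1 tc).
exists F, psi, A, A'; split; first by split.
- split.
  + move=> x t1 t1T; exact: (le_Rintegral_cutoff (f0 x) (ivs x) T0 thc th01 th1E t1T).
  + by move=> x; rewrite A'0 A'A.
  + move=> x; apply: (Rintegral_cutoff_le (f0 x) thc th01 (m _)); last exact: iv.
    by move=> t /=; rewrite !in_itv/= andbT => /andP[].
  + move=> x t1 xs t1T; rewrite /A' /a xs.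
    exact: (Rintegral_cutoff_tail (f0 x) (ivs x) T0 thc th01 t1T).
- apply: le_trans est _; rewrite lerD2r lerD2r lerD2l.
  have rp : rho `^ p * s `^ ((alpha + 1) * sigma / (sigma - 1)) = 1.
    rewrite -powRrM -powRD ?(gt_eqF s0) ?implybT// /p.
    by rewrite (_ : _ + _ = 0) ?powRr0//; ring.
  rewrite le_eqVlt; apply/orP; left; apply/eqP.
  rewrite !powRM ?(ltW K30) ?(ltW K20) ?powR_ge0// -/rho -/K2 -/cs /Kc.
  rewrite -[X in _ * X = _]mulr1.
  transitivity (lam `^ (- q) * ((K3 `^ p + K2 `^ p) * cs * (2 * C)) *
     (rho `^ p * s `^ ((alpha + 1) * sigma / (sigma - 1)))); last by rewrite rp mulr1.
  by ring.
Qed.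

End scale_estimate.

(** * The initial velocity and the conclusion *)

Section initial_velocity.
Context {R : realType} {V : countType}.
Variables (mu u1 : V -> R).
Hypothesis mu_ge0 : forall x, 0 <= mu x.
Hypothesis u1_def : sum_well_defined mu u1.
Hypothesis u1_ge0 : (0 <= signed_sum mu u1)%E.

(** A nonnegative total forces the negative part of [u1] to be summable, and then
    finitely many vertices carry a positive mass that compensates the whole
    negative part up to [e]; a weight equal to 1 on them and at most 1 elsewhere
    can only decrease the negative contribution. *)
Lemma initial_velocity_bound (e : R) : 0 < e ->
  exists Fe : {fset V}, forall (F : {fset V}) (psi : V -> R),
    (Fe `<=` F)%fset -> (forall x, 0 <= psi x <= 1) ->
    (forall x, x \in Fe -> psi x = 1) ->
    - \sum_(x <- F) u1 x * psi x * mu x <= e.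
Proof.
move=> e0; pose up x := Num.max (u1 x) 0 * mu x; pose um x := Num.max (- u1 x) 0 * mu x.
have up0 x : 0 <= up x by rewrite mulr_ge0// le_max lexx orbT.
have um0 x : 0 <= um x by rewrite mulr_ge0// le_max lexx orbT.
have uE x : u1 x * mu x = up x - um x.
  rewrite /up /um -mulrBl; congr (_ * _).
  by rewrite !maxEle; case: (leP (u1 x) 0) => ?; case: (leP (- u1 x) 0) => ?; lra.
have SN0 : (0 <= sum_neg mu u1)%E by apply: esum_ge0 => x _; rewrite lee_fin um0.
have SP0 : (0 <= sum_pos mu u1)%E by apply: esum_ge0 => x _; rewrite lee_fin up0.
have SNfin : sum_neg mu u1 \is a fin_num.
  rewrite ge0_fin_numE//; case: u1_def => // SP.
  rewrite ltNge leye_eq; apply/negP => /eqP N; move: u1_ge0.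
  have : sum_pos mu u1 \is a fin_num by rewrite ge0_fin_numE.
  rewrite /signed_sum N; by case: (sum_pos mu u1).
have NP : (sum_neg mu u1 <= sum_pos mu u1)%E.
  by move: u1_ge0; rewrite /signed_sum sube_ge0// SNfin.
set N := fine (sum_neg mu u1).
have NE : sum_neg mu u1 = N%:E by rewrite fineK.
have : ((N - e)%:E < sum_pos mu u1)%E.
  by apply: lt_le_trans NP; rewrite NE lte_fin; lra.
move=> /ereal_sup_gt[_ [S [Sfin _] <-]].
rewrite fsbig_finite// sumEFin lte_fin => SNe.
exists (fset_set S) => F psi SF psi01 psi1.
have negN : \sum_(x <- F) um x <= N.
  rewrite -lee_fin -NE; apply: (le_trans (ge_esum_fset um (S := [set: V]) _)) => //.
have posN : \sum_(x <- fset_set S) up x <= \sum_(x <- F) up x * psi x.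
  apply: (@le_trans _ _ (\sum_(x <- fset_set S) up x * psi x)).
    by apply: ler_sum_fset_in => x /psi1 ->; rewrite mulr1.
  apply: ler_sum_fset => // x; rewrite mulr_ge0//; by case/andP: (psi01 x).
have negpsi : \sum_(x <- F) um x * psi x <= \sum_(x <- F) um x.
  by apply: ler_sum => x _; rewrite ler_piMr//; case/andP: (psi01 x).
rewrite (eq_bigr (fun x => up x * psi x - um x * psi x)); last first.
  by move=> x _; rewrite mulrAC uE mulrBl.
rewrite sumrB; rewrite /up in SNe; lra.
Qed.

End initial_velocity.

Section vanishing.
Context {R : realType}.
Local Notation LT := (lebesgueType R).

Lemma ae_halfline (f : R -> R) :
  (forall s : R, 0 < s -> ae_eq (@leb R) (`[0, s]%classic : set LT) (EFin \o f) (cst 0%E)) ->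
  {ae (@leb R), forall t : R, 0 <= t -> f t = 0}.
Proof.
move=> f0; have fn n : (0 < n.+1%:R :> R) by [].
apply: negligibleS (negligible_bigcup (fun n => f0 _ (fn n))).
move=> t /= /not_implyP [t0 ft]; exists (Num.truncn t) => // H; apply: ft.
by apply/EFin_inj/H; rewrite /= in_itv/= t0 ltW// truncnS_gt.
Qed.

End vanishing.

Theorem theorem3p4 (R : realType) (V : countType)
    (omega : V -> V -> R) (mu : V -> R) (d : V -> V -> R) (x0 : V)
    (R0 alpha : R) (v : V -> R -> R) (sigma delta : R)
    (u : V -> R -> R) (u0 u1 : V -> R)
    (hgraph : weighted_graph omega mu)
    (hinf : infinite_set [set: V])
    (hA' : assumptionA' omega mu d x0 R0 alpha)
    (hvmeas : forall x,
      measurable_fun (`[0, +oo[ : set (lebesgueType R)) (v x))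
    (hvpos : forall x (t : R), 0 <= t -> 0 < v x t)
    (hsigma : 1 < sigma) (hdelta : 0 < delta)
    (hu : very_weak_solution omega mu v sigma u0 u1 u)
    (hu1_def : sum_well_defined mu u1)
    (hu1_ge0 : (0 <= signed_sum mu u1)%E)
    (hu0X : in_X mu d x0 delta u0) (hu1X : in_X mu d x0 delta u1)
    (huX : L1loc_X mu d x0 delta u)
    (hv : exists2 C : R, 0 < C & forall r : R, R0 <= r ->
      ((\int[leb]_(t in `[(r `^ ((1 + alpha) / 2))%R,
                         (2 * r `^ ((1 + alpha) / 2))%R])
         (\esum_(x in dball d x0 r)
           (v x t `^ (- (sigma - 1)^-1) * expR (- (delta * (d x x0 / r)))
              * mu x)%:E))
       <= (C * r `^ ((alpha + 1) * sigma / (sigma - 1)))%:E)%E /\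
      ((\int[leb]_(t in `[0%R, (2 * r `^ ((1 + alpha) / 2))%R])
         (\esum_(x in ~` dball d x0 r)
           (v x t `^ (- (sigma - 1)^-1) * expR (- (delta * (d x x0 / r)))
              * mu x)%:E))
       <= (C * r `^ ((alpha + 1) * sigma / (sigma - 1)))%:E)%E) :
  forall x, {ae (@leb R), forall t : R, 0 <= t -> u x t = 0}.
Proof.
case: hv => C C0 hv.
have mu0 x : 0 < mu x by exact: vertex_weight_gt0 hgraph x.
have a01 := A'_alpha hA'; have s1 := hsigma.
have [Kc [s0 [Kc0 scale]]] :=
  scale_estimate hgraph hA' hvmeas hvpos hsigma hdelta hu huX C0 hv.
set q := (sigma - 1)^-1 in scale; have q0 : 0 < q by rewrite invr_gt0; lra.
pose rea := reaction v sigma u.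
pose h (FT : {fset V} * R) := \sum_(x <- FT.1) mu x * rea x FT.2.
have rea0 x t : 0 <= rea x t.
  apply: Rintegral_ge0 => s /=; rewrite in_itv/= => /andP[s0' _].
  by rewrite mulr_ge0 ?powR_ge0// ltW// hvpos.
have u1P := initial_velocity_bound (fun x => ltW (mu0 x)) hu1_def hu1_ge0.
have large (F : {fset V}) (t : R) : exists s, [/\ s0 <= s, forall x, x \in F -> d x x0 < s &
    t < s `^ ((1 + alpha) / 2)].
  have [r rP] := fset_bounded (fun x => d x x0) F.
  pose T := Num.max 1 (t + 1).
  have T1 : 1 <= T by rewrite le_max lexx.
  have Tt : t + 1 <= T by rewrite le_max lexx orbT.
  exists (Num.max s0 (Num.max (r + 1) (T `^ (2 / (1 + alpha))))); split.
  - by rewrite le_max lexx.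
  - by move=> x /rP xr; rewrite !lt_max; apply/orP; right; apply/orP; left; lra.
  - apply: (@lt_le_trans _ _ T); first by lra.
    have TE : (T `^ (2 / (1 + alpha))) `^ ((1 + alpha) / 2) = T.
      rewrite -powRrM (_ : _ * _ = 1) ?powRr1//; first by lra.
      by field; case/andP: a01; lra.
    rewrite -[leLHS]TE ge0_ler_powR ?nnegrE ?powR_ge0//.
    + by case/andP: a01; lra.
    + by rewrite !le_max powR_ge0 !orbT.
    + by rewrite !le_max lexx !orbT.
have weightsum (F : {fset V}) (psi B : V -> R) : (forall x, 0 <= psi x <= 1) ->
    (forall x, 0 <= B x) -> \sum_(x <- F) psi x * mu x * B x <= \sum_(x <- F) mu x * B x.
  move=> psi01 B0; apply: ler_sum => x _; rewrite -mulrA ler_piMl ?mulr_ge0 ?(ltW (mu0 x))//.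
  by case/andP: (psi01 x).
have lower (F1 F : {fset V}) (psi A : V -> R) t : (F1 `<=` F)%fset ->
    (forall x, 0 <= psi x <= 1) -> (forall x, x \in F1 -> psi x = 1) ->
    (forall x, rea x t <= A x) -> h (F1, t) <= \sum_(x <- F) psi x * mu x * A x.
  move=> F1F psi01 psi1 rA; have A0 x : 0 <= A x by apply: le_trans (rA x); exact: rea0.
  apply: (@le_trans _ _ (\sum_(x <- F1) psi x * mu x * A x)).
    apply: ler_sum_fset_in => x /psi1 ->; rewrite mul1r ler_pM2l//.
  apply: ler_sum_fset => // x; rewrite !mulr_ge0 ?(ltW (mu0 x))//.
  by case/andP: (psi01 x).
(* With [lam = 1 / 4] half of the reaction sum is absorbed, the other half is
   bounded uniformly in the scale. *)
have [Bd hBd] : exists Bd, forall FT, h FT <= Bd.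
  have [Fu FuP] := u1P 1 ltr01.
  exists (2 * (4^-1 `^ (- q) * Kc + 2)) => -[F1 t].
  have [s [ss0 sF sT]] := large (F1 `|` Fu)%fset t.
  have lam0 : 0 < 4^-1 :> R by [].
  have [F [psi [A [A' [[F0F psi01 psi1] [rA A'A _ _] est]]]]] :=
    scale s 4^-1 1 (F1 `|` Fu)%fset ss0 lam0 ltr01.
  have /fsubUsetP[F1F FuF] : (F1 `|` Fu `<=` F)%fset by [].
  have psiF x : x \in (F1 `|` Fu)%fset -> psi x = 1 by move=> /sF /psi1.
  have low := lower F1 F psi A t F1F psi01 (fun x xF => psiF x (fsubsetP (fsubsetUl _ _) _ xF))
    (fun x => rA x t (ltW sT)).
  have uu := FuP F psi FuF psi01 (fun x xF => psiF x (fsubsetP (fsubsetUr _ _) _ xF)).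
  have AA : \sum_(x <- F) psi x * mu x * A' x <= \sum_(x <- F) psi x * mu x * A x.
    apply: ler_sum => x _; case/andP: (A'A x) => _ ?; rewrite ler_wpM2l// mulr_ge0 ?(ltW (mu0 x))//.
    by case/andP: (psi01 x).
  apply: (le_trans low); lra.
(* [F1] and [t1] nearly exhaust the finite total reaction, so that beyond them,
   where the derivatives of the test function live, at most [e] is left. *)
have small lam e : 0 < lam -> 0 < e -> forall FT,
    h FT <= (2 * lam + 3) * e + lam `^ (- q) * Kc.
  move=> lam0 e0 FT.
  have [[F1 t1] F1P] := sup_approx (fset0, 0) hBd e0.
  have [Fu FuP] := u1P e e0.
  have [s [ss0 sF sT]] := large (F1 `|` Fu)%fset t1.
  set T := s `^ ((1 + alpha) / 2) in sT.
  have [F [psi [A [A' [[F0F psi01 psi1] [rA A'A Ar A'r] est]]]]] :=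
    scale s lam e (F1 `|` Fu)%fset ss0 lam0 e0.
  have /fsubUsetP[F1F FuF] : (F1 `|` Fu `<=` F)%fset by [].
  have psiF x : x \in (F1 `|` Fu)%fset -> psi x = 1 by move=> /sF /psi1.
  have F1U x : x \in F1 -> x \in (F1 `|` Fu)%fset by apply/fsubsetP; exact: fsubsetUl.
  have low := lower F1 F psi A t1 F1F psi01 (fun x xF => psiF x (F1U x xF))
    (fun x => rA x t1 (ltW sT)).
  have uu := FuP F psi FuF psi01 (fun x xF => psiF x (fsubsetP (fsubsetUr _ _) _ xF)).
  have A'0 x : 0 <= A' x by case/andP: (A'A x).
  have tail : \sum_(x <- F) mu x * A' x <= e.
    have : \sum_(x <- F) mu x * A' x <= h (F, 2 * T) - h (F1, t1).
      rewrite /h/= (sum_fset_sub _ F1F) [X in _ - X]big_mkcond/= -sumrB; apply: ler_sum => x _.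
      case: ifPn => xF1.
        by rewrite -mulrBr ler_pM2l//; apply: A'r => //; apply/sF/F1U.
      by rewrite subr0 ler_pM2l//; apply: le_trans (Ar x); case/andP: (A'A x).
    by have := F1P (F, 2 * T); lra.
  have ws := weightsum F psi A' psi01 A'0.
  have lt_ : 2 * lam * \sum_(x <- F) psi x * mu x * A' x <= 2 * lam * e.
    by rewrite ler_pM2l ?mulr_gt0//; exact: le_trans tail.
  have := F1P FT; lra.
have h0 FT : h FT <= 0.
  apply/ler_addgt0Pl => eta eta0; rewrite addr0.
  (* the value of [lam] for which [lam `^ (- q) * Kc] is [eta / 2] *)
  pose lam := (2 * Kc / eta) `^ (sigma - 1).
  have lam0 : 0 < lam by rewrite powR_gt0// divr_gt0// mulr_gt0.
  have lamE : lam `^ (- q) * Kc = eta / 2.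
    rewrite /lam -powRrM mulrN mulfV ?gt_eqF ?subr_gt0// powR_inv1 ?divr_ge0 ?mulr_ge0 ?ltW//.
    by field; rewrite !gt_eqF.
  have e0 : 0 < eta / 2 / (2 * lam + 3) by rewrite !divr_gt0// addr_gt0// mulr_gt0.
  have := small lam _ lam0 e0 FT; rewrite lamE mulrC divfK ?gt_eqF//; last first.
    by rewrite addr_gt0// mulr_gt0.
  lra.
move=> x; apply: ae_halfline => s s_gt0.
have iv := vws_Lsigmaloc hu x s_gt0.
have ms := @lebesgue_measurable_itv R `[0, s].
have rx0 : rea x s = 0.
  apply/eqP; rewrite eq_le rea0 andbT.
  have := h0 ([fset x]%fset, s); rewrite /h/= big_seq_fset1.
  by rewrite pmulr_rle0.
have int0 : (\int[leb]_(t in `[0%R, s]) `|(`|u x t| `^ sigma * v x t)%:E| = 0)%E.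
  transitivity (\int[leb]_(t in `[0%R, s]) (`|u x t| `^ sigma * v x t)%:E)%E.
    apply: eq_integral => t; rewrite mem_setE in_itv/= => /andP[t0 _].
    by rewrite ger0_norm// mulr_ge0 ?powR_ge0// ltW// hvpos.
  rewrite -[LHS]fineK; last exact: integrable_fin_num.
  by congr EFin.
have mf : measurable_fun (`[0, s] : set (lebesgueType R))
    (fun t => (`|u x t| `^ sigma * v x t)%:E) by case/integrableP: iv.
have := (ae_eq_integral_abs (@leb R) ms mf).1 int0.
apply: filterS => t /= H ts; have /eqP := EFin_inj (H ts).
move: ts; rewrite in_itv/= => /andP[t0 _].
rewrite mulf_eq0 (gt_eqF (hvpos x t t0)) orbF powR_eq0 => /andP[/eqP ut _].
by rewrite (normr0_eq0 ut).
Qed.
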